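(* Let $t_0>0$ and let $\psi:[t_0,\infty)\to(0,\infty)$ be a differentiable function satisfying $$\int_{t_0}^\infty \frac{dt}{\psi(t)}<\infty$$ and $$K\le \frac{t\psi'(t)}{\psi(t)}\le L\qquad (t\ge t_0)$$ for some constants $K,L$ with $0<K\le 1<L<2$. Let $f$ be a function with a direct tract $D$, and let $z_r\in D$ with $|z_r|=r$ and $|f(z_r)|=M(r,f,D)$. Then there exists a set $F\subset[1,\infty)$ of finite logarithmic measure such that $$f(z)\sim\left(\frac{z}{z_r}\right)^{a(r,f,D)}f(z_r)\quad\text{for}\quad |z-z_r|\le\frac{r}{\sqrt{\psi(a(r,f,D))}}$$ as $r\to\infty$, $r\notin F$.
   Context: Direct tract: Let $D$ be an unbounded domain in $\mathbb{C}$ whose boundary consists of piecewise smooth curves, and suppose that the complement of $D$ is unbounded. Let $f$ be a complex-valued function whose domain of definition contains the closure $\overline{D}$ of $D$. Then $D$ is called a direct tract of $f$ if $f$ is holomorphic in $D$ and continuous in $\overline{D}$ and there exists $R>0$ such that $|f(z)|=R$ for $z\in\partial D$ while $|f(z)|>R$ for $z\in D$. For $r>0$ such that $D$ meets the circle $|z|=r$ (this is the case for all large $r$), put $M(r,f,D):=\max_{|z|=r,\,z\in D}|f(z)|$. The function $\log M(r,f,D)$ is convex in $\log r$, and $a(r,f,D)$ denotes the right derivative of $\log M(r,f,D)$ with respect to $\log r$. It is nondecreasing in $r$, and it is known that $a(r,f,D)\to\infty$ as $r\to\infty$, so $\psi(a(r,f,D))$ is defined for all large $r$. A set $F\subset[1,\infty)$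 has finite logarithmic measure if $\int_F dt/t<\infty$. The power $(z/z_r)^{a(r,f,D)}$ is taken with the branch equal to $1$ at $z=z_r$ (principal branch; $z/z_r$ is close to $1$). The asymptotic relation is uniform in $z$: for every $\varepsilon>0$ there is $r_0$ such that for all $r\ge r_0$ with $r\notin F$ the indicated closed disk around $z_r$ is contained in $D$ and $\left|f(z)\big/\big((z/z_r)^{a(r,f,D)}f(z_r)\big)-1\right|<\varepsilon$ for all $z$ in it. *)

(* Defs.v *)
From HB Require Import structures.
From mathcomp Require Import all_boot all_order all_algebra.
From mathcomp Require Import complex.
From mathcomp Require Import all_classical all_reals all_analysis.

Set Implicit Arguments.
Unset Strict Implicit.
Unset Printing Implicit Defensive.

Import Order.TTheory GRing.Theory Num.Theory numFieldNormedType.Exports.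
Export ComplexField.Normc.

Local Open Scope classical_set_scope.
Local Open Scope complex_scope.
Local Open Scope ring_scope.

(* The topology of R[i] is that of its norm: these are the instances that
   numFieldNormedType provides for the abstract structures. As R[i] is a
   normed module over itself, derivability in direction 1 on R[i] is complex
   differentiability. *)
#[warnings="-redundant-canonical-projection", non_forgetful_inheritance]
HB.instance Definition _ (R : realType) := GRing.ComAlgebra.copy R[i] R[i]^o.
#[warnings="-redundant-canonical-projection", non_forgetful_inheritance]
HB.instance Definition _ (R : realType) := Vector.copy R[i] R[i]^o.
#[warnings="-redundant-canonical-projection", non_forgetful_inheritance]
HB.instance Definition _ (R : realType) := NormedModule.copy R[i] R[i]^o.

(* Derivatives relative to a set of real parameters: one-sided at the
   endpoints of an interval. *)
Definition has_derivative_within (R : realType) (A : set R) (g : R -> R)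
    (t l : R) : Prop :=
  (fun s : R => (g s - g t) / (s - t)) @ within A t^' --> l.

Definition has_cderivative_within (R : realType) (A : set R) (g : R -> R[i])
    (t : R) (l : R[i]) : Prop :=
  (fun s : R => (g s - g t) / (s - t)%:C) @ within A t^' --> l.

Definition smooth_on (R : realType) (a b : R) (g : R -> R[i]) : Prop :=
  exists g' : R -> R[i],
    {within `[a, b], continuous g'} /\
    (forall t : R, t \in `[a, b] ->
       has_cderivative_within `[a, b] g t (g' t) /\ g' t != 0).

(* The parameter set I may be any nondegenerate interval, since a boundary
   curve of an unbounded domain may be unbounded at either end; every compact
   part of the curve is a finite concatenation of smooth arcs. *)
Definition piecewise_smooth_curve (R : realType) (I : set R) (g : R -> R[i])
    : Prop :=
  [/\ is_interval I,
      exists a b : R, [/\ a < b, I a & I b]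
    & forall a b : R, a < b -> `[a, b] `<=` I ->
        exists s : seq R, itv_partition a b s /\
          (forall i : nat, (i < size s)%N ->
             smooth_on (nth b (a :: s) i) (nth b s i) g)].

Definition boundary (R : realType) (D : set R[i]) : set R[i] :=
  closure D `\` interior D.

(* A countable family of curves; repetitions are allowed, so finite families
   are included. *)
Definition piecewise_smooth_boundary (R : realType) (D : set R[i]) : Prop :=
  exists (I : nat -> set R) (g : nat -> R -> R[i]),
    (forall n : nat, piecewise_smooth_curve (I n) (g n)) /\
    boundary D = \bigcup_n (g n @` I n).

(* Only the values of f on closure D matter. *)
Definition direct_tract (R : realType) (f : R[i] -> R[i]) (D : set R[i])
    : Prop :=
  [/\ [/\ open D, connected D & ~ bounded_set D],
      piecewise_smooth_boundary D,
      ~ bounded_set (~` D),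
      (forall z : R[i], D z -> derivable f z 1) /\
        {within closure D, continuous f}
    & exists2 rho : R, 0 < rho &
        (forall z : R[i], boundary D z -> normc (f z) = rho) /\
        (forall z : R[i], D z -> rho < normc (f z))].

(* For a direct tract this supremum is a maximum as soon as D meets the
   circle, because |f| is larger inside D than on its boundary. *)
Definition max_modulus (R : realType) (f : R[i] -> R[i]) (D : set R[i])
    (r : R) : R :=
  sup [set normc (f z) | z in [set z | D z /\ normc z = r]].

Definition right_derivative (R : realType) (g : R -> R) (x : R) : R :=
  lim ((fun h : R => (g (x + h) - g x) / h) @ 0^'+).

(* The right derivative of log M(r,f,D) with respect to log r. *)
Definition tract_index (R : realType) (f : R[i] -> R[i]) (D : set R[i])
    (r : R) : R :=
  right_derivative (fun x : R => ln (max_modulus f D (expR x))) (ln r).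

(* The argument of w <> 0 in ]-pi, pi]. *)
Definition principal_arg (R : realType) (w : R[i]) : R :=
  let theta := acos (complex.Re w / normc w) in
  if 0 <= complex.Im w then theta else - theta.

(* The principal branch of w^a for real a and w <> 0. *)
Definition principal_power (R : realType) (w : R[i]) (a : R) : R[i] :=
  let theta := a * principal_arg w in
  (normc w `^ a)%:C * (cos theta +i* sin theta).

(* Main.v *)
(* Let v = log |f / rho| on the tract, v = 0 elsewhere; v is subharmonic, and its
   maximum Phi (x) on |z| = e^x is convex. Write a for the right derivative of
   Phi. Since the integral of 1 / psi converges, outside a small set of x the
   index a varies so little on the scale 1 / sqrt (psi (a (x))) that
   Phi (x + h) <= Phi (x) + a (x) h + o(1). Then the quotient F of f by
   (z / z_r)^a f (z_r), with F (z_r) = 1, satisfies |F| <= 1 + o(1) on a large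
   multiple of the disk, and |F| is small near the complement of D. Such an F
   cannot meet the complement of D near z_r: otherwise F takes a value w of
   modulus 1/4 at some p near z_r, the subharmonic function |F - w| e^(32 |F|)
   extends across the complement by a constant, as its values are smallest where
   F is small, and its zero at p makes it too small at z_r. So F is holomorphic in
   the disk, with a modulus almost maximal at the centre, and the
   Borel-Caratheodory inequality yields F = 1 + o(1).

   That a tends to infinity follows from the same argument applied to f (e^s): if
   a were bounded, then Phi would be almost affine on arbitrarily long intervals
   and D would contain all large circles.

   The only integration needed in the complex plane is Goursat's theorem; all
   applications of the maximum principle go through functions that have local
   minorants |H| with H holomorphic. *)

Require Import Defs.
From HB Require Import structures.
From mathcomp Require Import all_boot all_order all_algebra.
From mathcomp Require Import complex ring lra.
From mathcomp Require Import all_classical all_reals all_analysis.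
From mathcomp Require Import measurable_realfun.

Import Order.TTheory GRing.Theory Num.Theory numFieldNormedType.Exports.

Local Open Scope classical_set_scope.
Local Open Scope complex_scope.
Local Open Scope ring_scope.

Set Implicit Arguments.
Unset Strict Implicit.
Unset Printing Implicit Defensive.

(** The square root in the radius balances two scales. The levels of the index are spaced by e
    sqrt(psi); on a window of half length B / sqrt(psi) that meets no level crossing the index moves
    by at most one such step, so Phi leaves its tangent by at most B e. The windows to be discarded
    have total length governed by the sum of 1 / sqrt(psi) over the levels, which is 1 / e times a
    Riemann sum for the integral of 1 / psi. The upper bound on t psi' / psi makes psi / t^2
    nonincreasing, so consecutive levels have bounded ratio and the integral controls this sum.
    Since F may not depend on the error, the exceptional sets for errors proportional to 1 / (j +
    1), with sizes proportional to 2^-j, are united. In the plane nothing is known about the shape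
    of D near z_r, so containment of the disk has to follow from the size of F alone. The constants
    multiply up: 40 for containment and 8 for Borel-Caratheodory give 320, and a factor 6 for
    passing to the logarithm gives 1920. *)

Local Notation Re := complex.Re.
Local Notation Im := complex.Im.

(** * The real-valued modulus of complex numbers *)

Section Modulus.
Context {R : realType}.
Implicit Types (x y : R) (z w : R[i]).

Lemma normc_sqrt z : normc z = Num.sqrt (Re z ^+ 2 + Im z ^+ 2).
Proof. by case: z. Qed.

Lemma normc_ge0 z : 0 <= normc z.
Proof. by rewrite normc_sqrt sqrtr_ge0. Qed.

Lemma normc_sqr z : normc z ^+ 2 = Re z ^+ 2 + Im z ^+ 2.
Proof. by rewrite normc_sqrt sqr_sqrtr// addr_ge0 ?sqr_ge0. Qed.

Lemma normc_eq0 z : (normc z == 0) = (z == 0).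
Proof.
by apply/eqP/eqP => [/eq0_normc//|->]; rewrite normc0.
Qed.

Lemma normc_gt0 z : (0 < normc z) = (z != 0).
Proof. by rewrite lt_def normc_ge0 andbT normc_eq0. Qed.

Lemma normcB z w : normc (z - w) = normc (w - z).
Proof. by rewrite -normcN opprB. Qed.

Lemma normc_real x : normc x%:C = `|x|.
Proof. by rewrite normc_sqrt /= expr0n addr0 sqrtr_sqr. Qed.

Lemma Re_le_normc z : `|Re z| <= normc z.
Proof.
by rewrite normc_sqrt -sqrtr_sqr ler_wsqrtr// lerDl sqr_ge0.
Qed.

Lemma Im_le_normc z : `|Im z| <= normc z.
Proof.
by rewrite normc_sqrt -[leLHS]sqrtr_sqr ler_wsqrtr// lerDr sqr_ge0.
Qed.

Lemma normc_le_ReIm z : normc z <= `|Re z| + `|Im z|.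
Proof.
rewrite -(ler_pXn2r (n := 2)) ?nnegrE ?normc_ge0 ?addr_ge0// normc_sqr.
rewrite sqrrD !real_normK ?num_real//.
by rewrite lerD2r lerDl mulrn_wge0// mulr_ge0.
Qed.

Lemma normc_ge_sub z w : normc z - normc w <= normc (z - w).
Proof. by rewrite lerBlDr (le_trans _ (le_normcD _ _))// subrK. Qed.

Lemma normcX z n : normc (z ^+ n) = normc z ^+ n.
Proof. by elim: n => [|n ih]; rewrite ?expr0 ?normc1// !exprS normcM ih. Qed.

End Modulus.

(** * Complex differentiability with explicit real radii *)

Section Derivative.
Context {R : realType}.
Implicit Types (g k : R[i] -> R[i]) (z w l : R[i]).

(** The norm carried by [R[i]] takes values in [R[i]]; real radii measured by [normc] keep every
    estimate inside real arithmetic. [nbhs_cnear] identifies this notion with the neighbourhood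
    filter. *)
Definition cnear z (P : R[i] -> Prop) :=
  exists2 d : R, 0 < d & forall w, normc (w - z) < d -> P w.

Lemma cnearI z (P Q : R[i] -> Prop) :
  cnear z P -> cnear z Q -> cnear z (fun w => P w /\ Q w).
Proof.
move=> [d d0 dP] [e e0 eQ]; exists (Num.min d e); first by rewrite lt_min d0.
by move=> w; rewrite lt_min => /andP[/dP ? /eQ].
Qed.

Lemma cnear_mono z (P Q : R[i] -> Prop) :
  (forall w, P w -> Q w) -> cnear z P -> cnear z Q.
Proof. by move=> PQ [d d0 dP]; exists d => // w /dP /PQ. Qed.

Lemma cnear_self z (P : R[i] -> Prop) : cnear z P -> P z.
Proof. by case=> d d0; apply; rewrite subrr normc0. Qed.

(** There is no quotient and no punctured neighbourhood, so that composition needs no separate case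
    for points w with g w = g z. *)
Definition cderiv g z l :=
  forall e : R, 0 < e ->
    cnear z (fun w => normc (g w - g z - l * (w - z)) <= e * normc (w - z)).

Definition ccont (T : R[i] -> R) z :=
  forall e : R, 0 < e -> cnear z (fun w => `|T w - T z| < e).

Definition cholo g z := cnear z (fun w => exists l, cderiv g w l).

Lemma cderiv_ext g k z l :
  cnear z (fun w => g w = k w) -> cderiv g z l -> cderiv k z l.
Proof.
move=> gk gz e /gz; move: (gk) => /cnear_self <- gz'.
by apply: cnear_mono (cnearI gk gz') => w [<-].
Qed.

Lemma cderiv_cst c z : cderiv (fun=> c) z 0.
Proof.
move=> e e0; exists 1 => // w _.
by rewrite subrr mul0r subr0 normc0 mulr_ge0 ?normc_ge0// ltW.
Qed.

Lemma cderiv_id z : cderiv id z 1.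
Proof.
move=> e e0; exists 1 => // w _.
by rewrite mul1r subrr normc0 mulr_ge0 ?normc_ge0// ltW.
Qed.

Lemma cderivD g k z a b :
  cderiv g z a -> cderiv k z b -> cderiv (fun w => g w + k w) z (a + b).
Proof.
move=> ga kb e e0.
have e20 : 0 < e / 2 by lra.
apply: cnear_mono (cnearI (ga _ e20) (kb _ e20)) => w [h1 h2].
have -> : g w + k w - (g z + k z) - (a + b) * (w - z) =
  (g w - g z - a * (w - z)) + (k w - k z - b * (w - z)) by ring.
apply: le_trans (le_normcD _ _) _.
by rewrite (_ : e * _ = e / 2 * normc (w - z) + e / 2 * normc (w - z)) ?lerD//; field.
Qed.

Lemma cderiv_near_bound g z l : cderiv g z l ->
  cnear z (fun w => normc (g w - g z) <= (normc l + 1) * normc (w - z)).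
Proof.
move=> /(_ 1 ltr01); apply: cnear_mono => w h.
rewrite (_ : g w - g z = g w - g z - l * (w - z) + l * (w - z)); last by ring.
apply: le_trans (le_normcD _ _) _; rewrite normcM; lra.
Qed.

Lemma cderiv_cont g z l : cderiv g z l ->
  forall e : R, 0 < e -> cnear z (fun w => normc (g w - g z) < e).
Proof.
move=> /cderiv_near_bound h e e0.
have c0 : 0 < normc l + 1 by have := normc_ge0 l; lra.
have : cnear z (fun w => normc (w - z) < e / (normc l + 1)).
  by exists (e / (normc l + 1)) => //; rewrite divr_gt0.
move=> /(cnearI h); apply: cnear_mono => w [h1].
rewrite ltr_pdivlMr// => h2; lra.
Qed.

Lemma cderiv_comp g k z a b :
  cderiv g z a -> cderiv k (g z) b -> cderiv (fun w => k (g w)) z (b * a).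
Proof.
move=> ga kb e e0.
pose c := normc a + 1.
have c0 : 0 < c by rewrite /c; have := normc_ge0 a; lra.
have b0 : 0 < normc b + 1 by have := normc_ge0 b; lra.
have [d d0 dk] := kb (e / 2 / c) (divr_gt0 (divr_gt0 e0 (ltr0Sn _ 1)) c0).
have h1 := cderiv_near_bound ga.
have h2 := cderiv_cont ga d0.
have h3 := ga (e / 2 / (normc b + 1)) (divr_gt0 (divr_gt0 e0 (ltr0Sn _ 1)) b0).
apply: cnear_mono (cnearI h1 (cnearI h2 h3)) => w [{}h1 [/dk {}h2 {}h3]].
have -> : k (g w) - k (g z) - b * a * (w - z) =
  (k (g w) - k (g z) - b * (g w - g z)) + b * (g w - g z - a * (w - z)) by ring.
apply: le_trans (le_normcD _ _) _; rewrite normcM.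
have -> : e * normc (w - z) = e / 2 / c * (c * normc (w - z)) +
   (normc b + 1) * (e / 2 / (normc b + 1) * normc (w - z)).
  by field; rewrite !gt_eqF.
apply: lerD.
  apply: le_trans h2 _; rewrite ler_pM2l//.
  by rewrite !divr_gt0.
apply: ler_pM => //; rewrite ?normc_ge0//.
lra.
Qed.

Lemma cderivM g k z a b : cderiv g z a -> cderiv k z b ->
  cderiv (fun w => g w * k w) z (a * k z + g z * b).
Proof.
move=> ga kb e e0.
have Pk : 0 < normc (k z) + 1 by have := normc_ge0 (k z); lra.
have Pg : 0 < normc (g z) + 1 by have := normc_ge0 (g z); lra.
have Pb : 0 < normc a + 1 by have := normc_ge0 a; lra.
have e30 : 0 < e / 3 by lra.
have h1 := ga _ (divr_gt0 e30 Pk).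
have h2 := kb _ (divr_gt0 e30 Pg).
have h3 := cderiv_near_bound ga.
have h4 := cderiv_cont kb (divr_gt0 e30 Pb).
apply: cnear_mono (cnearI (cnearI h1 h2) (cnearI h3 h4)).
move=> w [[{}h1 {}h2] [{}h3 {}h4]].
have -> : g w * k w - g z * k z - (a * k z + g z * b) * (w - z) =
  k z * (g w - g z - a * (w - z)) + g z * (k w - k z - b * (w - z))
  + (g w - g z) * (k w - k z) by ring.
have -> : e * normc (w - z) =
  (normc (k z) + 1) * (e / 3 / (normc (k z) + 1) * normc (w - z)) +
  (normc (g z) + 1) * (e / 3 / (normc (g z) + 1) * normc (w - z)) +
  ((normc a + 1) * normc (w - z)) * (e / 3 / (normc a + 1)).
  by field; rewrite !gt_eqF.
apply: le_trans (le_normcD _ _) _; apply: lerD; rewrite ?normcM.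
  apply: le_trans (le_normcD _ _) _; apply: lerD; rewrite normcM;
  by apply: ler_pM => //; rewrite ?normc_ge0// lerDl.
by apply: ler_pM => //; rewrite ?normc_ge0// ltW.
Qed.

Lemma cderivZ g z c a : cderiv g z a -> cderiv (fun w => c * g w) z (c * a).
Proof.
move=> ga; have := cderivM (cderiv_cst c z) ga.
by rewrite mul0r add0r.
Qed.

Lemma cderivV z : z != 0 -> cderiv (fun w => w^-1) z (- z ^- 2).
Proof.
move=> z0 e e0; have nz0 : 0 < normc z by rewrite normc_gt0.
exists (Num.min (normc z / 2) (e * normc z ^+ 3 / 2)).
  by rewrite lt_min !(divr_gt0, mulr_gt0, exprn_gt0).
move=> w; rewrite lt_min => /andP[h1 h2].
have wz : normc z / 2 < normc w.
  by have := normc_ge_sub z w; rewrite normcB; lra.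
have nw0 : 0 < normc w by lra.
have w0 : w != 0 by rewrite -normc_gt0.
have -> : w^-1 - z^-1 - - z ^- 2 * (w - z) = (w - z) ^+ 2 / (w * z ^+ 2).
  by field; rewrite w0 z0.
rewrite normcM normcX normcV normcM normcX exprS expr1.
rewrite ler_pdivrMr; last by rewrite mulr_gt0// exprn_gt0.
rewrite [leRHS]mulrAC ler_wpM2r ?normc_ge0//.
apply: le_trans (ltW h2) _.
rewrite (_ : _ / 2 = e * ((normc z / 2) * normc z ^+ 2)); last by field.
by rewrite ler_pM2l// ler_pM2r ?exprn_gt0// ltW.
Qed.

End Derivative.

(** * The complex exponential and the principal argument *)

Section Exponential.
Context {R : realType}.
Implicit Types (x y : R) (z w : R[i]).

Lemma is_derive_near (g : R -> R) x l (e : R) : is_derive x 1 g l -> 0 < e ->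
  exists2 d : R, 0 < d &
    forall h, `|h| < d -> `|g (x + h) - g x - l * h| <= e * `|h|.
Proof.
move=> [dg gl] e0.
have : h^-1 *: (g (h *: 1 + x) - g x) @[h --> 0^'] --> l by rewrite -gl; exact: dg.
move=> /cvgr_dist_lt /(_ _ e0) [d /= d0 dP].
exists d => // h hd; have [->|h0] := eqVneq h 0.
  by rewrite !addr0 subrr mulr0 subrr normr0 mulr0.
have := dP h; rewrite /= sub0r normrN => /(_ hd h0).
rewrite -[h *: 1]/(h * 1) -[_ *: _]/(h^-1 * _) mulr1 [h + x]addrC => H.
rewrite -ler_pdivrMr ?normr_gt0// -normf_div ltW// -normrN.
by rewrite (_ : - _ = l - h^-1 * (g (x + h) - g x)) //; field.
Qed.

Definition cexp z : R[i] := (expR (Re z))%:C * (cos (Im z) +i* sin (Im z)).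

Lemma cexpD z w : cexp (z + w) = cexp z * cexp w.
Proof.
rewrite /cexp !raddfD/= expRD rmorphM/=.
rewrite sinD cosD mulrACA; congr (_ * _).
by apply/eqP; rewrite eq_complex /= eqxx/= addrC; apply/eqP; congr (_ + _); rewrite mulrC.
Qed.

Lemma normc_cexp z : normc (cexp z) = expR (Re z).
Proof.
rewrite /cexp normcM normc_real ger0_norm ?expR_ge0// normc_sqrt/=.
by rewrite cos2Dsin2 sqrtr1 mulr1.
Qed.

Lemma cexp0 : cexp 0 = 1.
Proof. by rewrite /cexp /= expR0 cos0 sin0 mul1r. Qed.

Lemma cexp_neq0 z : cexp z != 0.
Proof. by rewrite -normc_gt0 normc_cexp expR_gt0. Qed.

Lemma cexpN z : cexp (- z) = (cexp z)^-1.
Proof.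
by apply: (mulfI (cexp_neq0 z)); rewrite -cexpD subrr cexp0 mulfV ?cexp_neq0.
Qed.

(** The addition theorem carries differentiability from the origin to every point, so the real
    derivatives of exp, cos and sin are only needed at 0. *)
Lemma cderiv_cexp0 : cderiv cexp 0 1.
Proof.
move=> e e0.
have e80 : 0 < e / 8 by lra.
have m0 : 0 < Num.min (e / 8) 1 by rewrite lt_min e80 ltr01.
have [d1 d10 h1] := is_derive_near (is_derive_expR 0) m0.
have [d2 d20 h2] := is_derive_near (is_derive_cos 0) m0.
have [d3 d30 h3] := is_derive_near (is_derive_sin 0) m0.
exists (Num.min (Num.min d1 1) (Num.min (Num.min d2 d3) (e / 16))).
  by rewrite !lt_min d10 d20 d30 ltr01 /=; lra.
move=> w; rewrite subr0 cexp0 mul1r !lt_min.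
move=> /andP[/andP[wd1 w1] /andP[/andP[wd2 wd3] we]].
case: w wd1 w1 wd2 wd3 we => x y; set w := x +i* y => wd1 w1 wd2 wd3 we.
have xw : `|x| <= normc w := Re_le_normc w.
have yw : `|y| <= normc w := Im_le_normc w.
have := h1 x (le_lt_trans xw wd1); rewrite add0r expR0 mul1r => {}h1.
have := h2 y (le_lt_trans yw wd2); rewrite add0r cos0 sin0 oppr0 mul0r subr0 => {}h2.
have := h3 y (le_lt_trans yw wd3); rewrite add0r cos0 sin0 subr0 mul1r => {}h3.
have min1 : Num.min (e / 8) 1 <= e / 8 by rewrite ge_min lexx.
have min2 : Num.min (e / 8) 1 <= 1 by rewrite ge_min lexx orbT.
have n0 := normc_ge0 w.
have H1 : `|expR x - 1 - x| <= e / 8 * normc w.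
  by apply: le_trans h1 _; apply: ler_pM => //; exact: ltW.
have H1' : `|expR x - 1| <= 2 * normc w.
  rewrite (_ : expR x - 1 = (expR x - 1 - x) + x); last by ring.
  apply: le_trans (ler_normD _ _) _.
  have : Num.min (e / 8) 1 * `|x| <= `|x| by rewrite ler_piMl.
  by lra.
have H2 : `|cos y - 1| <= e / 8 * normc w.
  by apply: le_trans h2 _; apply: ler_pM => //; exact: ltW.
have H3 : `|sin y - y| <= e / 8 * normc w.
  by apply: le_trans h3 _; apply: ler_pM => //; exact: ltW.
have C1 : `|cos y| <= 1 by exact: cos_max.
have S1 : `|sin y| <= 2 * normc w.
  rewrite (_ : sin y = (sin y - y) + y); last by ring.
  apply: le_trans (ler_normD _ _) _.
  have : Num.min (e / 8) 1 * `|y| <= `|y| by rewrite ler_piMl.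
  by lra.
apply: le_trans (normc_le_ReIm _) _.
have -> : Re (cexp w - 1 - w) = (expR x - 1 - x) * cos y + (1 + x) * (cos y - 1).
  by rewrite /=; ring.
have -> : Im (cexp w - 1 - w) = (expR x - 1) * sin y + (sin y - y).
  by rewrite /=; ring.
have A1 : `|(expR x - 1 - x) * cos y| <= e / 8 * normc w.
  by rewrite normrM -[leRHS]mulr1 ler_pM.
have A2 : `|(1 + x) * (cos y - 1)| <= 2 * (e / 8 * normc w).
  rewrite normrM ler_pM//; apply: le_trans (ler_normD _ _) _; rewrite normr1; lra.
have A3 : `|(expR x - 1) * sin y| <= 2 * normc w * (2 * normc w).
  by rewrite normrM ler_pM.
have A4 : 2 * normc w * (2 * normc w) <= e / 4 * normc w.
  by rewrite mulrA; apply: ler_wpM2r => //; lra.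
have B1 := ler_normD ((expR x - 1 - x) * cos y) ((1 + x) * (cos y - 1)).
have B2 := ler_normD ((expR x - 1) * sin y) (sin y - y).
have p0 : 0 <= e * normc w by apply: mulr_ge0 => //; exact: ltW.
lra.
Qed.

Lemma cderiv_cexp z : cderiv cexp z (cexp z).
Proof.
have h : cderiv (fun w => w + - z) z 1.
  by rewrite -[1]addr0; exact: cderivD (cderiv_id z) (cderiv_cst _ z).
have h2 : cderiv cexp (z + - z) 1 by rewrite subrr; exact: cderiv_cexp0.
have := cderivZ (cexp z) (cderiv_comp h h2).
rewrite !mulr1; apply: cderiv_ext.
exists 1 => // w _ /=; rewrite -cexpD; congr cexp; ring.
Qed.

Lemma cexp_periodic z : cexp (z + 0 +i* (pi *+ 2)) = cexp z.
Proof.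
rewrite /cexp /= raddfD /= addr0; congr (_ * _).
by rewrite raddfD /= sinD2pi cosD2pi.
Qed.

Lemma principal_argP z : z != 0 ->
  `|principal_arg z| <= pi /\
  z = cexp (ln (normc z) +i* principal_arg z).
Proof.
move=> z0; have n0 : 0 < normc z by rewrite normc_gt0.
set t := Re z / normc z.
have t1 : -1 <= t <= 1.
  rewrite -ler_norml /t normf_div ler_pdivrMr ?normr_gt0 ?gt_eqF// mul1r.
  by rewrite [`|normc z|]gtr0_norm// Re_le_normc.
have a0 : 0 <= acos t by apply: acos_ge0.
have api : acos t <= pi by apply: acos_lepi.
split.
  rewrite /principal_arg -/t; case: ifP => _; rewrite ?normrN ger0_norm//.
(* This is sin (acos t), which only sees the absolute value of Im z; the case distinction in
   [principal_arg] restores the sign. *)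
have sq : Num.sqrt (1 - t ^+ 2) = `|Im z| / normc z.
  have -> : 1 - t ^+ 2 = (Im z / normc z) ^+ 2.
    rewrite /t; have := normc_sqr z => h.
    by rewrite !expr_div_n h; field; rewrite -h expf_eq0 /= gt_eqF.
  by rewrite sqrtr_sqr normf_div [`|normc z|]gtr0_norm.
rewrite /cexp lnK ?posrE//.
rewrite [LHS]complexE /principal_arg -/t.
case: ifPn => [im|im] /=; rewrite ?cosN ?sinN acosK// sin_acos// sq.
  rewrite ger0_norm//; apply/eqP; rewrite eq_complex /= /t.
  by apply/andP; split; apply/eqP; field; rewrite gt_eqF.
rewrite ler0_norm; last by rewrite ltW// ltNge.
apply/eqP; rewrite eq_complex /= /t.
by apply/andP; split; apply/eqP; field; rewrite gt_eqF.
Qed.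

Lemma principal_power_cexp z a : z != 0 ->
  principal_power z a = cexp (a%:C * (ln (normc z) +i* principal_arg z)).
Proof.
move=> z0; have n0 : 0 < normc z by rewrite normc_gt0.
rewrite /principal_power /cexp /= !mul0r subr0 addr0; congr (_%:C * _).
by rewrite /powR gt_eqF.
Qed.

End Exponential.

(** * Integrals of continuous functions over segments *)

Section SegmentIntegral.
Context {R : realType}.
Notation mu := (@lebesgue_measure R).
Implicit Types (a b c k e : R) (g h : R -> R).

Definition segint g a b : R := \int[mu]_(x in `[a, b]) g x.

Definition cont_seg g a b := forall x, a <= x -> x <= b -> {for x, continuous g}.

Lemma cont_seg_integrable g a b : cont_seg g a b ->
  mu.-integrable `[a, b] (EFin \o g).
Proof.
move=> gc; apply: continuous_compact_integrable; first exact: segment_compact.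
apply: continuous_in_subspaceT => x; rewrite inE/= in_itv/= => /andP[]; exact: gc.
Qed.

Lemma segint_split g a c b : a <= c -> c <= b -> cont_seg g a b ->
  segint g a b = segint g a c + segint g c b.
Proof.
move=> ac cb gc; have ig := cont_seg_integrable gc.
have := @Rintegral_itvB R g (BLeft a) (BRight b) c ig.
rewrite !bnd_simp => /(_ ac cb) h.
rewrite /segint -(@Rintegral_itv_obnd_cbnd _ c (BRight b)); first by rewrite -h addrC subrK.
apply: integrableS ig => //; apply: subset_itvr; by rewrite bnd_simp.
Qed.

Lemma segintD g h a b : cont_seg g a b -> cont_seg h a b ->
  segint (fun x => g x + h x) a b = segint g a b + segint h a b.
Proof. by move=> gc hc; rewrite /segint RintegralD//; exact: cont_seg_integrable. Qed.

Lemma segint_cst k a b : a <= b -> segint (fun=> k) a b = k * (b - a).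
Proof.
move=> ab; rewrite /segint Rintegral_cst//= lebesgue_measure_itv/= lte_fin.
by case: ltgtP ab => // -> _; rewrite subrr.
Qed.

Lemma le_segint g h a b : cont_seg g a b -> cont_seg h a b ->
  (forall x, a <= x -> x <= b -> g x <= h x) -> segint g a b <= segint h a b.
Proof.
move=> gc hc gh; apply: le_Rintegral => //; [exact: cont_seg_integrable..|].
by move=> x /=; rewrite in_itv/= => /andP[]; exact: gh.
Qed.

Lemma segint_near_cst g k e a b : a <= b -> cont_seg g a b ->
  (forall x, a <= x -> x <= b -> `|g x - k| <= e) ->
  `|segint g a b - k * (b - a)| <= e * (b - a).
Proof.
move=> ab gc gk.
have cc (l : R) : cont_seg (fun=> l) a b by move=> x _ _; exact: cvg_cst.
have h1 : segint g a b <= segint (fun=> k + e) a b.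
  by apply: le_segint => // x ax xb; have := gk x ax xb; rewrite ler_distl => /andP[].
have h2 : segint (fun=> k - e) a b <= segint g a b.
  by apply: le_segint => // x ax xb; have := gk x ax xb; rewrite ler_distl => /andP[].
move: h1 h2; rewrite !segint_cst// ler_distl => h1 h2.
by apply/andP; split; lra.
Qed.

Lemma eq_segint g h a b : (forall x, a <= x -> x <= b -> g x = h x) ->
  segint g a b = segint h a b.
Proof.
move=> gh; apply: eq_Rintegral => x; rewrite inE/= in_itv/= => /andP[]; exact: gh.
Qed.

End SegmentIntegral.

(** * Boundary integrals over rectangles *)

Section Goursat.
Context {R : realType}.
Implicit Types (G : R[i] -> R[i]) (a b c d : R).

Lemma ccont_slice_x (T : R[i] -> R) (x y : R) : ccont T (x +i* y) ->
  {for x, continuous (fun t : R => T (t +i* y))}.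
Proof.
move=> Tc; apply/cvgrPdist_lt => e e0; have [d d0 dT] := Tc e e0.
near=> t; rewrite distrC; apply: dT.
rewrite (_ : t +i* y - x +i* y = (t - x)%:C); last first.
  by apply/eqP; rewrite eq_complex /= subrr !eqxx.
rewrite normc_real distrC; near: t.
by apply: cvgr_dist_lt => //; exact: cvg_id.
Unshelve. all: by end_near. Qed.

Lemma ccont_slice_y (T : R[i] -> R) (x y : R) : ccont T (x +i* y) ->
  {for y, continuous (fun t : R => T (x +i* t))}.
Proof.
move=> Tc; apply/cvgrPdist_lt => e e0; have [d d0 dT] := Tc e e0.
near=> t; rewrite distrC; apply: dT.
apply: le_lt_trans (normc_le_ReIm _) _; rewrite /= subrr normr0 add0r distrC.
near: t; by apply: cvgr_dist_lt => //; exact: cvg_id.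
Unshelve. all: by end_near. Qed.

Lemma cderiv_ccontRe G z l : cderiv G z l -> ccont (fun w => Re (G w)) z.
Proof.
move=> Gz e e0; apply: cnear_mono (cderiv_cont Gz e0) => w.
by apply: le_lt_trans; rewrite -raddfB; exact: Re_le_normc.
Qed.

Lemma cderiv_ccontIm G z l : cderiv G z l -> ccont (fun w => Im (G w)) z.
Proof.
move=> Gz e e0; apply: cnear_mono (cderiv_cont Gz e0) => w.
by apply: le_lt_trans; rewrite -raddfB; exact: Im_le_normc.
Qed.

(* The imaginary part of the integral of G dz along the boundary of the
   rectangle [a, b] x [c, d]. *)
Definition bdint G a b c d : R :=
  segint (fun x => Im (G (x +i* c)) - Im (G (x +i* d))) a b +
  segint (fun y => Re (G (b +i* y)) - Re (G (a +i* y))) c d.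

Definition holo_rect G a b c d := forall x y, a <= x -> x <= b ->
  c <= y -> y <= d -> exists l, cderiv G (x +i* y) l.

Lemma holo_rect_contx G a b c d y y' : holo_rect G a b c d ->
  c <= y -> y <= d -> c <= y' -> y' <= d ->
  cont_seg (fun x => Im (G (x +i* y)) - Im (G (x +i* y'))) a b.
Proof.
move=> GH cy yd cy' yd' x ax xb.
have [l hl] := GH x y ax xb cy yd.
have [l' hl'] := GH x y' ax xb cy' yd'.
apply: cvgB; first exact: (ccont_slice_x (cderiv_ccontIm hl)).
exact: (ccont_slice_x (cderiv_ccontIm hl')).
Qed.

Lemma holo_rect_conty G a b c d x x' : holo_rect G a b c d ->
  a <= x -> x <= b -> a <= x' -> x' <= b ->
  cont_seg (fun y => Re (G (x +i* y)) - Re (G (x' +i* y))) c d.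
Proof.
move=> GH cy yd cy' yd' y ax xb.
have [l hl] := GH x y cy yd ax xb.
have [l' hl'] := GH x' y cy' yd' ax xb.
apply: cvgB; first exact: (ccont_slice_y (cderiv_ccontRe hl)).
exact: (ccont_slice_y (cderiv_ccontRe hl')).
Qed.

Lemma bdint_splitx G a m b c d : a <= m -> m <= b -> c <= d ->
  holo_rect G a b c d ->
  bdint G a b c d = bdint G a m c d + bdint G m b c d.
Proof.
move=> am mb cd GH; have ab := le_trans am mb.
rewrite /bdint (@segint_split _ _ a m b)//; last exact: holo_rect_contx GH _ _ _ _.
rewrite (@eq_segint _ (fun y => Re (G (b +i* y)) - Re (G (a +i* y)))
  (fun y => (Re (G (m +i* y)) - Re (G (a +i* y))) +
    (Re (G (b +i* y)) - Re (G (m +i* y))))); last by move=> *; ring.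
rewrite [segint _ c d in LHS]segintD; [ring|exact: holo_rect_conty GH _ _ _ _|
  exact: holo_rect_conty GH _ _ _ _].
Qed.

Lemma bdint_splity G a b c m d : a <= b -> c <= m -> m <= d ->
  holo_rect G a b c d ->
  bdint G a b c d = bdint G a b c m + bdint G a b m d.
Proof.
move=> ab cm md GH; have cd := le_trans cm md.
rewrite /bdint (@segint_split _ _ c m d)//; last exact: holo_rect_conty GH _ _ _ _.
rewrite (@eq_segint _ (fun x => Im (G (x +i* c)) - Im (G (x +i* d)))
  (fun x => (Im (G (x +i* c)) - Im (G (x +i* m))) +
    (Im (G (x +i* m)) - Im (G (x +i* d))))); last by move=> *; ring.
rewrite [segint _ a b in LHS]segintD; [ring|exact: holo_rect_contx GH _ _ _ _|
  exact: holo_rect_contx GH _ _ _ _].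
Qed.

Lemma holo_rectS G a b c d a' b' c' d' : a <= a' -> b' <= b -> c <= c' ->
  d' <= d -> holo_rect G a b c d -> holo_rect G a' b' c' d'.
Proof.
move=> h1 h2 h3 h4 GH x y x1 x2 y1 y2.
by apply: GH; [exact: le_trans x1|exact: le_trans h2|exact: le_trans y1|exact: le_trans h4].
Qed.

(* Affine maps contribute nothing, so only the remainder is integrated. *)
Lemma bdint_affine_bound G a b c d z l e : a <= b -> c <= d ->
  holo_rect G a b c d ->
  (forall x y, a <= x -> x <= b -> c <= y -> y <= d ->
     normc (G (x +i* y) - G z - l * (x +i* y - z)) <= e) ->
  `|bdint G a b c d| <= 2 * e * ((b - a) + (d - c)).
Proof.
move=> ab cd GH GE.
have h1 : `|segint (fun x => Im (G (x +i* c)) - Im (G (x +i* d))) a b -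
    Re l * (c - d) * (b - a)| <= 2 * e * (b - a).
  apply: segint_near_cst => //; first exact: holo_rect_contx GH _ _ _ _.
  move=> x ax xb.
  have u := le_trans (Im_le_normc _) (GE x c ax xb (lexx _) cd).
  have v := le_trans (Im_le_normc _) (GE x d ax xb cd (lexx _)).
  have -> : Im (G (x +i* c)) - Im (G (x +i* d)) - Re l * (c - d) =
    Im (G (x +i* c) - G z - l * (x +i* c - z)) -
    Im (G (x +i* d) - G z - l * (x +i* d - z)).
    case: (G _) => ? ?; case: (G _) => ? ?; case: (G _) => ? ?.
    by case: (l) => ? ?; case: (z) => ? ? /=; ring.
  by apply: le_trans (ler_normB _ _) _; lra.
have h2 : `|segint (fun y => Re (G (b +i* y)) - Re (G (a +i* y))) c d -
    Re l * (b - a) * (d - c)| <= 2 * e * (d - c).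
  apply: segint_near_cst => //; first exact: holo_rect_conty GH _ _ _ _.
  move=> y cy yd.
  have u := le_trans (Re_le_normc _) (GE b y ab (lexx _) cy yd).
  have v := le_trans (Re_le_normc _) (GE a y (lexx _) ab cy yd).
  have -> : Re (G (b +i* y)) - Re (G (a +i* y)) - Re l * (b - a) =
    Re (G (b +i* y) - G z - l * (b +i* y - z)) -
    Re (G (a +i* y) - G z - l * (a +i* y - z)).
    case: (G _) => ? ?; case: (G _) => ? ?; case: (G _) => ? ?.
    by case: (l) => ? ?; case: (z) => ? ? /=; ring.
  by apply: le_trans (ler_normB _ _) _; lra.
rewrite /bdint; set I := segint _ a b in h1 *; set K := segint _ c d in h2 *.
have -> : I + K = (I - Re l * (c - d) * (b - a)) + (K - Re l * (b - a) * (d - c)) by ring.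
by apply: le_trans (ler_normD _ _) _; lra.
Qed.

End Goursat.

(** * Goursat's theorem, the mean value property and strict maxima *)

Section Cauchy.
Context {R : realType}.
Implicit Types (G : R[i] -> R[i]) (a b c d : R).

Lemma goursat G a b c d : a <= b -> c <= d -> holo_rect G a b c d ->
  bdint G a b c d = 0.
Proof.
move=> ab cd GH; apply: contrapT => /eqP J0.
pose len (r : R * R * R * R) := (r.1.1.2 - r.1.1.1) + (r.2 - r.1.2).
pose J (r : R * R * R * R) := bdint G r.1.1.1 r.1.1.2 r.1.2 r.2.
pose nested (r s : R * R * R * R) :=
  [/\ s.1.1.1 <= r.1.1.1, r.1.1.2 <= s.1.1.2, s.1.2 <= r.1.2 & r.2 <= s.2].
pose r0 := (a, b, c, d).
(* Small enough for [r0] to be bad; the + 1 covers a degenerate rectangle. Halving the sides divides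
   [len] squared by 4, so one of the four quarters of a bad rectangle is bad again. *)
pose e := `|J r0| / (2 * (len r0 ^+ 2 + 1)).
have J0' : 0 < `|J r0| by rewrite normr_gt0.
have l0 : 0 < len r0 ^+ 2 + 1 by have := sqr_ge0 (len r0); lra.
have e0 : 0 < e by rewrite divr_gt0// mulr_gt0.
pose bad r := [/\ r.1.1.1 <= r.1.1.2, r.1.2 <= r.2, nested r r0 &
  e * len r ^+ 2 < `|J r|].
have step r : exists r', bad r -> [/\ bad r', nested r' r & len r' = len r / 2].
  have [br|nb] := pselect (bad r); last by exists r.
  case: (br); case: r br => [[[a1 b1] c1] d1]; rewrite /nested/= => br ab1 cd1 [na nb nc nd].
  rewrite /len/J/= => JJ.
  pose m := (a1 + b1) / 2; pose p := (c1 + d1) / 2.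
  have [am mb cp pd] : [/\ a1 <= m, m <= b1, c1 <= p & p <= d1].
    by rewrite /m /p; split; lra.
  have GH1 : holo_rect G a1 b1 c1 d1 by apply: holo_rectS GH.
  have E : bdint G a1 b1 c1 d1 = (bdint G a1 m c1 p + bdint G a1 m p d1) +
    (bdint G m b1 c1 p + bdint G m b1 p d1).
    rewrite (@bdint_splitx _ _ a1 m b1)//; congr (_ + _); apply: bdint_splity => //.
      exact: holo_rectS GH1.
    exact: holo_rectS GH1.
  suff [r' h] : exists r', bad r' /\ nested r' (a1, b1, c1, d1) /\
      len r' = len (a1, b1, c1, d1) / 2.
    by exists r' => _; case: h => ? [? ?].
  have mk a' b' c' d' : a1 <= a' -> b' <= b1 -> c1 <= c' -> d' <= d1 ->
      a' <= b' -> c' <= d' -> (b' - a') + (d' - c') = ((b1 - a1) + (d1 - c1)) / 2 ->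
      e * ((b1 - a1) + (d1 - c1)) ^+ 2 / 4 < `|bdint G a' b' c' d'| ->
      exists r', bad r' /\ nested r' (a1, b1, c1, d1) /\
      len r' = len (a1, b1, c1, d1) / 2.
    move=> n1 n2 n3 n4 n5 n6 n7 n8; exists (a', b', c', d'); split; last by split.
    split; [exact: n5|exact: n6| |].
      by split => /=; [exact: le_trans na n1|exact: le_trans n2 nb|
        exact: le_trans nc n3|exact: le_trans n4 nd].
    by apply: le_lt_trans n8; rewrite /len /= n7 le_eqVlt; apply/orP; left; apply/eqP; field.
  case: (ltP (e * ((b1 - a1) + (d1 - c1)) ^+ 2 / 4) `|bdint G a1 m c1 p|) => [h|h1].
    by apply: (mk a1 m c1 p); [..|exact: h] => //; rewrite /m /p; field.
  case: (ltP (e * ((b1 - a1) + (d1 - c1)) ^+ 2 / 4) `|bdint G a1 m p d1|) => [h|h2].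
    by apply: (mk a1 m p d1); [..|exact: h] => //; rewrite /m /p; field.
  case: (ltP (e * ((b1 - a1) + (d1 - c1)) ^+ 2 / 4) `|bdint G m b1 c1 p|) => [h|h3].
    by apply: (mk m b1 c1 p); [..|exact: h] => //; rewrite /m /p; field.
  case: (ltP (e * ((b1 - a1) + (d1 - c1)) ^+ 2 / 4) `|bdint G m b1 p d1|) => [h|h4].
    by apply: (mk m b1 p d1); [..|exact: h] => //; rewrite /m /p; field.
  exfalso; move: JJ; rewrite E => JJ.
  have t1 := ler_normD (bdint G a1 m c1 p + bdint G a1 m p d1)
    (bdint G m b1 c1 p + bdint G m b1 p d1).
  have t2 := ler_normD (bdint G a1 m c1 p) (bdint G a1 m p d1).
  have t3 := ler_normD (bdint G m b1 c1 p) (bdint G m b1 p d1).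
  by lra.
have [nx nxP] := choice step.
pose rs n := iter n nx r0.
have b0 : bad r0.
  split => //; rewrite -/(len r0) /e mulrAC ltr_pdivrMr ?mulr_gt0//.
  by rewrite ltr_pM2l//; lra.
have bs n : bad (rs n) by elim: n => [//|n ih]; case: (nxP _ ih).
have ns n : nested (rs n.+1) (rs n) by case: (nxP _ (bs n)).
have ls n : len (rs n) = len r0 / 2 ^+ n.
  elim: n => [|n ih]; first by rewrite expr0 divr1.
  case: (nxP _ (bs n)) => _ _; rewrite -[nx _]/(rs n.+1) => ->; rewrite ih exprS; field.
  by rewrite expf_neq0.
have nm n m : nested (rs (n + m)%N) (rs n).
  elim: m => [|m [h1 h2 h3 h4]]; first by rewrite addn0; split.
  rewrite addnS; case: (ns (n + m)%N) => k1 k2 k3 k4.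
  by split; [exact: le_trans k1|exact: le_trans h2|exact: le_trans k3|exact: le_trans h4].
have cross n m : (rs n).1.1.1 <= (rs m).1.1.2 /\ (rs n).1.2 <= (rs m).2.
  case/orP: (leq_total n m) => /subnK <-; rewrite addnC.
    case: (nm n (m - n)%N) => h1 h2 h3 h4; case: (bs (n + (m - n))%N) => k1 k2 _ _.
    by split; [exact: le_trans k1|exact: le_trans k2].
  case: (nm m (n - m)%N) => h1 h2 h3 h4; case: (bs (m + (n - m))%N) => k1 k2 _ _.
  by split; [exact: le_trans k1 _|exact: le_trans k2 _].
pose x := sup (range (fun n => (rs n).1.1.1)).
pose y := sup (range (fun n => (rs n).1.2)).
have xb n : (rs n).1.1.1 <= x <= (rs n).1.1.2.
  apply/andP; split.
    apply: ub_le_sup; last by exists n.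
    by exists (rs 0%N).1.1.2 => _ [m _ <-]; case: (cross m 0%N).
  apply: ge_sup; first by exists (rs 0%N).1.1.1; exists 0%N.
  by move=> _ [m _ <-]; case: (cross m n).
have yb n : (rs n).1.2 <= y <= (rs n).2.
  apply/andP; split.
    apply: ub_le_sup; last by exists n.
    by exists (rs 0%N).2 => _ [m _ <-]; case: (cross m 0%N).
  apply: ge_sup; first by exists (rs 0%N).1.2; exists 0%N.
  by move=> _ [m _ <-]; case: (cross m n).
have [/andP[xa xbb] /andP[yc yd]] := (xb 0%N, yb 0%N).
have [l hl] := GH x y xa xbb yc yd.
have [dl dl0 hd] := hl _ (divr_gt0 e0 (ltr0Sn _ 1)).
have [n nd] : exists n, len r0 / 2 ^+ n < dl.
  have lr0 : 0 <= len r0 by rewrite /len /=; lra.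
  have ln0 : 0 <= len r0 / dl by apply: divr_ge0 => //; exact: ltW.
  exists (Num.bound (len r0 / dl)).
  rewrite ltr_pdivrMr ?exprn_gt0// mulrC -ltr_pdivrMr//.
  apply: lt_le_trans (archi_boundP ln0) _.
  by rewrite -natrX ler_nat ltnW// ltn_expl.
case: (bs n) => rab rcd [/= ra rb rc rd] rJ.
have /andP[xna xnb] := xb n; have /andP[ync ynd] := yb n.
have ln : 0 <= len (rs n) by rewrite /len; lra.
have := rJ; rewrite ltNge => /negP; apply.
(* Differentiability at the limit point with error e / 2 bounds the remainder by e / 2 * len;
   [bdint_affine_bound] then gives exactly the bound that badness forbids. *)
rewrite (_ : e * _ = 2 * (e / 2 * len (rs n)) * len (rs n)); last by field.
apply: (@bdint_affine_bound _ G _ _ _ _ (x +i* y) l) => //.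
  exact: holo_rectS GH.
move=> x' y' h1 h2 h3 h4.
have dist : normc (x' +i* y' - x +i* y) <= len (rs n).
  apply: le_trans (normc_le_ReIm _) _; rewrite /len /=.
  by apply: lerD; rewrite ler_norml; clear -xna xnb ync ynd h1 h2 h3 h4; apply/andP; split; lra.
apply: le_trans (hd _ _) _; first by apply: le_lt_trans dist _; rewrite ls.
by rewrite ler_pM2l//; lra.
Qed.

(** Circles around q become vertical segments under z = q + exp s. The horizontal sides of a
    rectangle of height 2 pi cancel by periodicity, so Goursat's theorem makes the integral
    independent of the radius, and a small radius gives the value at q. *)
Lemma mean_value G q x :
  (forall z, normc (z - q) <= expR x -> exists l, cderiv G z l) ->
  segint (fun y => Re (G (q + cexp (x +i* y)))) 0 (pi *+ 2) = Re (G q) * (pi *+ 2).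
Proof.
move=> GH; have p0 : 0 < pi *+ 2 :> R by rewrite mulrn_wgt0// pi_gt0.
pose K s := G (q + cexp s).
have KH s : Re s <= x -> exists l, cderiv K s l.
  move=> sx; case: (GH (q + cexp s)).
    by rewrite addrC addKr normc_cexp ler_expR.
  move=> l hl; exists (l * (0 + cexp s)).
  apply: (@cderiv_comp _ (fun w => q + cexp w) G) hl.
  by apply: cderivD (cderiv_cst _ _) (cderiv_cexp s).
have Kc x' : x' <= x -> cont_seg (fun y => Re (K (x' +i* y))) 0 (pi *+ 2).
  move=> xx y _ _; have [l hl] := KH (x' +i* y) xx.
  exact: ccont_slice_y (cderiv_ccontRe hl).
have shift x' : x' <= x -> segint (fun y => Re (K (x +i* y))) 0 (pi *+ 2) =
    segint (fun y => Re (K (x' +i* y))) 0 (pi *+ 2).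
  move=> xx; have RH : holo_rect K x' x 0 (pi *+ 2).
    by move=> u v _ ux _ _; exact: KH.
  have := goursat xx (ltW p0) RH; rewrite /bdint.
  rewrite (@eq_segint _ _ (fun=> 0) x' x); last first.
    move=> u _ _; rewrite /K -(cexp_periodic (u +i* 0)).
    rewrite (_ : u +i* 0 + _ = u +i* (pi *+ 2)) ?subrr//.
    by apply/eqP; rewrite eq_complex /= addr0 add0r !eqxx.
  rewrite (segint_cst _ xx) mul0r add0r => h.
  rewrite (@eq_segint _ (fun y => Re (K (x +i* y)))
    (fun y => (Re (K (x +i* y)) - Re (K (x' +i* y))) + Re (K (x' +i* y)))); last first.
    by move=> *; rewrite subrK.
  rewrite segintD ?h ?add0r//; last exact: Kc.
  by apply: (holo_rect_conty RH).
apply/eqP; rewrite -subr_eq0 -normr_le0; apply/ler_addgt0Pr => e e0; rewrite add0r.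
have q0 : exists l, cderiv G q l by apply: GH; rewrite subrr normc0 expR_ge0.
have [l hl] := q0.
have [d d0 hd] := cderiv_cont hl (divr_gt0 e0 p0).
pose x' := Num.min x (ln (d / 2)).
have xx : x' <= x by rewrite ge_min lexx.
rewrite -/(K _) (shift _ xx).
have -> : e = e / (pi *+ 2) * (pi *+ 2 - 0) by rewrite subr0 divfK ?gt_eqF.
rewrite -[in X in _ - X](subr0 (pi *+ 2)).
apply: segint_near_cst; [exact: ltW|exact: Kc|] => y _ _.
rewrite -raddfB; apply: le_trans (Re_le_normc _) _; rewrite ltW// hd//.
rewrite addrC addKr normc_cexp /=.
have : expR x' <= d / 2.
  by rewrite -[leRHS]lnK ?posrE ?divr_gt0// ler_expR ge_min lexx orbT.
by lra.
Qed.

(** The mean of Re (G / G q) over a small circle is 1, while Gaussian decay of |G| around q bounds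
    it by a constant below 1. Asking for this quantitative strictness avoids the discussion of
    equality in the maximum principle. *)
Lemma no_strict_max G q k : 0 < k -> cholo G q -> G q != 0 ->
  ~ cnear q (fun z => normc (G z) <= normc (G q) * expR (- (k * normc (z - q) ^+ 2))).
Proof.
move=> k0 GH Gq GM; have [d d0 hd] := cnearI GH GM.
have p0 : 0 < pi *+ 2 :> R by rewrite mulrn_wgt0// pi_gt0.
pose x := ln (d / 2); have ex : expR x = d / 2 by rewrite lnK// posrE divr_gt0.
pose H z := (G q)^-1 * G z.
have HH z : normc (z - q) <= expR x -> exists l, cderiv H z l.
  rewrite ex => zq; have [|[l hl] _] := hd z; first by lra.
  by exists ((G q)^-1 * l); exact: cderivZ.
have := mean_value HH; rewrite {2}/H mulVf//= mul1r => E.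
have small : expR (- (k * (d / 2) ^+ 2)) < 1.
  by rewrite expR_lt1 oppr_lt0 mulr_gt0// exprn_gt0// divr_gt0.
have : segint (fun y => Re (H (q + cexp (x +i* y)))) 0 (pi *+ 2) <=
    segint (fun=> expR (- (k * (d / 2) ^+ 2))) 0 (pi *+ 2).
  apply: le_segint; [|by move=> ? _ _; exact: cvg_cst|].
    move=> y _ _; apply: (ccont_slice_y (T := fun s => Re (H (q + cexp s)))).
    have [l hl] : exists l, cderiv H (q + cexp (x +i* y)) l.
      by apply: HH; rewrite addrC addKr normc_cexp.
    apply: (@cderiv_ccontRe _ (fun s => H (q + cexp s))).
    apply: (@cderiv_comp _ (fun w => q + cexp w) H) hl.
    by apply: cderivD (cderiv_cst _ _) (cderiv_cexp _).
  move=> y _ _; apply: le_trans (ler_norm _) _; apply: le_trans (Re_le_normc _) _.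
  rewrite /H normcM normcV mulrC ler_pdivrMr ?normc_gt0// mulrC.
  have [|_] := hd (q + cexp (x +i* y)).
    by rewrite addrC addKr normc_cexp ex; lra.
  by rewrite [_ - q]addrC addKr normc_cexp ex.
rewrite E (segint_cst _ (ltW p0)). rewrite subr0 => h.
have := ltr_pM2r p0 (expR (- (k * (d / 2) ^+ 2))) 1; rewrite small mul1r; lra.
Qed.

End Cauchy.

(** * Continuity of real functions on the plane and attained maxima *)

Section Continuity.
Context {R : realType}.
Implicit Types (S T : R[i] -> R) (z : R[i]).

Lemma ccont_cst (c : R) z : ccont (fun=> c) z.
Proof. by move=> e e0; exists 1 => // w _; rewrite subrr normr0. Qed.

Lemma ccont_ext S T z : cnear z (fun w => S w = T w) -> ccont S z -> ccont T z.
Proof.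
move=> ST Sc e /Sc; have := cnear_self ST => <- Sc'.
by apply: cnear_mono (cnearI ST Sc') => w [<-].
Qed.

Lemma ccont_comp T (phi : R -> R) z :
  {for T z, continuous phi} -> ccont T z -> ccont (fun w => phi (T w)) z.
Proof.
move=> phic Tc e e0.
move/cvgrPdist_lt : phic => /(_ _ e0) [d /= d0 dphi].
apply: cnear_mono (Tc _ d0) => w Tw; rewrite distrC.
by apply: dphi => /=; rewrite distrC.
Qed.

Lemma ccontD S T z : ccont S z -> ccont T z -> ccont (fun w => S w + T w) z.
Proof.
move=> Sc Tc e e0; have e20 : 0 < e / 2 by lra.
apply: cnear_mono (cnearI (Sc _ e20) (Tc _ e20)) => w [h1 h2].
rewrite opprD addrACA; apply: le_lt_trans (ler_normD _ _) _; lra.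
Qed.

(** Polarization reduces the product to squares, which are compositions with a real function. *)
Lemma ccontM S T z : ccont S z -> ccont T z -> ccont (fun w => S w * T w) z.
Proof.
have sq U : ccont U z -> ccont (fun w => U w ^+ 2) z.
  by move=> Uc; apply: (@ccont_comp U (fun x => x ^+ 2)) => //; exact: exprn_continuous.
have sc (c : R) U : ccont U z -> ccont (fun w => c * U w) z.
  by move=> Uc; apply: (@ccont_comp U (fun x => c * x)) => //; exact: mulrl_continuous.
move=> Sc Tc.
have := ccontD (sc (2^-1) _ (sq _ (ccontD Sc Tc)))
  (ccontD (sc (- 2^-1) _ (sq _ Sc)) (sc (- 2^-1) _ (sq _ Tc))).
by apply: ccont_ext; exists 1 => // w _; field.
Qed.

Lemma ccont_max S T z : ccont S z -> ccont T z ->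
  ccont (fun w => Num.max (S w) (T w)) z.
Proof.
move=> Sc Tc e e0; apply: cnear_mono (cnearI (Sc _ e0) (Tc _ e0)) => w [].
rewrite !ltr_norml => /andP[h1 h2] /andP[h3 h4].
rewrite /Num.max; case: ifP => h5; case: ifP => h6; apply/andP; split; try lra.
Qed.

Lemma ccont_normc (g : R[i] -> R[i]) z l : cderiv g z l -> ccont (fun w => normc (g w)) z.
Proof.
move=> gl e e0; apply: cnear_mono (cderiv_cont gl e0) => w gw.
have := normc_ge_sub (g w) (g z); have := normc_ge_sub (g z) (g w).
rewrite (normcB (g z)) ltr_norml => *; apply/andP; split; lra.
Qed.

Lemma ccont_Re z : ccont (@complex.Re R) z.
Proof.
move=> e e0; exists e => // w h.
by apply: le_lt_trans h; rewrite -raddfB; exact: Re_le_normc.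
Qed.

Lemma ccont_lt T z c : ccont T z -> T z < c -> cnear z (fun w => T w < c).
Proof.
move=> Tc cT; have e0 : 0 < c - T z by lra.
by apply: cnear_mono (Tc _ e0) => w; rewrite ltr_norml => /andP[_]; lra.
Qed.

Lemma ccont_gt T z c : ccont T z -> c < T z -> cnear z (fun w => c < T w).
Proof.
move=> Tc cT; have e0 : 0 < T z - c by lra.
by apply: cnear_mono (Tc _ e0) => w; rewrite ltr_norml => /andP[+ _]; lra.
Qed.

Definition in_rect (a b c d : R) (z : R[i]) :=
  [/\ a <= Re z, Re z <= b, c <= Im z & Im z <= d].

Lemma rect_EVT T a b c d : a <= b -> c <= d ->
  (forall z, in_rect a b c d z -> ccont T z) ->
  exists2 q, in_rect a b c d q & forall z, in_rect a b c d z -> T z <= T q.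
Proof.
move=> ab cd Tc.
pose A := `[a, b]%classic `*` `[c, d]%classic : set (R * R)%type.
pose f (p : R * R) := T (p.1 +i* p.2).
have cA : compact A by apply: compact_setX; exact: segment_compact.
have A0 : A !=set0 by exists (a, c); split; rewrite /= in_itv/= lexx.
have fA : {within A, continuous f}.
  apply: continuous_in_subspaceT => -[x y]; rewrite inE => -[/=].
  rewrite !in_itv/= => /andP[x1 x2] /andP[y1 y2].
  apply/cvgrPdist_lt => e e0.
  have [dl dl0 hd] : cnear (x +i* y) (fun w => `|T w - T (x +i* y)| < e).
    by apply: Tc.
  have d20 : 0 < dl / 2 by lra.
  exists (ball x (dl / 2), ball y (dl / 2)) => /=.
    by split; apply: nbhsx_ballx.
  move=> [x' y'] [/= xx yy]; rewrite /f/= distrC; apply: hd.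
  apply: le_lt_trans (normc_le_ReIm _) _ => /=.
  rewrite (distrC x') (distrC y').
  by move: xx yy; rewrite -!ball_normE/=; lra.
have [[x y]] := compact_EVT_max A0 cA fA.
rewrite inE => -[/=]; rewrite !in_itv/= => /andP[x1 x2] /andP[y1 y2] H.
exists (x +i* y) => // -[x' y'] [/= h1 h2 h3 h4].
by apply: (H (x', y')); rewrite inE; split; rewrite /= in_itv/= ?h1 ?h2 ?h3 ?h4.
Qed.

End Continuity.

(** * Holomorphic minorants and the maximum principle *)

Section Subharmonic.
Context {R : realType}.
Implicit Types (m : R[i] -> R) (g H : R[i] -> R[i]) (z q : R[i]).

Lemma cholo_id z : cholo id z.
Proof. by exists 1 => // w _; exists 1; exact: cderiv_id. Qed.

Lemma cholo_cst c z : cholo (fun=> c) z.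
Proof. by exists 1 => // w _; exists 0; exact: cderiv_cst. Qed.

Lemma choloD g H z : cholo g z -> cholo H z -> cholo (fun w => g w + H w) z.
Proof.
move=> gh Hh; apply: cnear_mono (cnearI gh Hh) => w [[l hl] [k hk]].
by exists (l + k); exact: cderivD.
Qed.

Lemma choloM g H z : cholo g z -> cholo H z -> cholo (fun w => g w * H w) z.
Proof.
move=> gh Hh; apply: cnear_mono (cnearI gh Hh) => w [[l hl] [k hk]].
by exists (l * H w + g w * k); exact: cderivM.
Qed.

Lemma choloX g z n : cholo g z -> cholo (fun w => g w ^+ n) z.
Proof.
move=> gz; elim: n => [|n ih]; first exact: cholo_cst.
apply: cnear_mono (choloM gz ih) => w [l hl]; exists l; apply: cderiv_ext hl.
by exists 1 => // u _; rewrite exprS.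
Qed.

Lemma cholo_cont g z : cholo g z -> ccont (fun w => normc (g w)) z.
Proof. by move=> /cnear_self[l]; exact: ccont_normc. Qed.

Lemma cholo_comp g H z : cholo g z -> cholo H (g z) -> cholo (fun w => H (g w)) z.
Proof.
move=> gz [d d0 hd]; have [l hl] := cnear_self gz.
apply: cnear_mono (cnearI gz (cderiv_cont hl d0)) => w [[k hk] /hd[j hj]].
by exists (j * k); exact: cderiv_comp hj.
Qed.

Lemma cholo_cexp z : cholo (@cexp R) z.
Proof. by exists 1 => // w _; exists (cexp w); exact: cderiv_cexp. Qed.

Lemma choloV g z : cholo g z -> g z != 0 -> cholo (fun w => (g w)^-1) z.
Proof.
move=> gz g0; have c := ccont_gt (cholo_cont gz) (_ : 0 < normc (g z)).
have {}c := c ltac:(by rewrite normc_gt0).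
apply: cnear_mono (cnearI gz c) => w [[l hl]]; rewrite normc_gt0 => gw.
by exists (- (g w) ^- 2 * l); apply: cderiv_comp hl (cderivV gw).
Qed.

(* A form of subharmonicity of log m stable under products, maxima and gluing. *)
Definition supported m z := exists H,
  [/\ cholo H z, normc (H z) = m z & cnear z (fun w => normc (H w) <= m w)].

Lemma supported_normc g z : cholo g z -> supported (fun w => normc (g w)) z.
Proof. by move=> gz; exists g; split => //; exists 1. Qed.

Lemma supported_cst (c : R) z : 0 <= c -> supported (fun=> c) z.
Proof.
move=> c0; exists (fun=> c%:C); split; first exact: cholo_cst.
  by rewrite normc_real ger0_norm.
by exists 1 => // w _; rewrite normc_real ger0_norm.
Qed.

Lemma supported_below m1 m2 z : cnear z (fun w => m1 w <= m2 w) -> m1 z = m2 z ->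
  supported m1 z -> supported m2 z.
Proof.
move=> le12 eq12 [H [Hh Hz Hn]]; exists H; split; rewrite -?eq12//.
by apply: cnear_mono (cnearI le12 Hn) => w [h1 h2]; exact: le_trans h1.
Qed.

Lemma supportedM m1 m2 z : supported m1 z -> supported m2 z ->
  supported (fun w => m1 w * m2 w) z.
Proof.
move=> [H1 [h1 e1 n1]] [H2 [h2 e2 n2]].
exists (fun w => H1 w * H2 w); split; first exact: choloM.
  by rewrite normcM e1 e2.
apply: cnear_mono (cnearI n1 n2) => w [{}n1 {}n2].
by rewrite normcM ler_pM ?normc_ge0.
Qed.

(** Rotate g by the constant u that makes u g real and nonnegative at z: Re (u g) touches |g| from
    below there. If g z = 0, division by zero makes u = 0, which serves as well. *)
Lemma supported_expR_normc g (c : R) z : 0 <= c -> cholo g z ->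
  supported (fun w => expR (c * normc (g w))) z.
Proof.
move=> c0 gz; pose u := (normc (g z))%:C / g z.
have u1 : normc u <= 1.
  rewrite /u normcM normcV normc_real ger0_norm ?normc_ge0//.
  have [->|g0] := eqVneq (g z) 0; first by rewrite normc0 mul0r.
  by rewrite divff// normc_eq0.
have ug : u * g z = (normc (g z))%:C.
  have [->|g0] := eqVneq (g z) 0; first by rewrite normc0 mulr0.
  by rewrite /u divfK.
exists (fun w => cexp (c%:C * u * g w)); split.
- apply: (@cholo_comp (fun w => c%:C * u * g w) (@cexp R)); last exact: cholo_cexp.
  exact: choloM (cholo_cst _ _) gz.
- by rewrite normc_cexp -mulrA ug -rmorphM.
- exists 1 => // w _; rewrite normc_cexp ler_expR.
  apply: le_trans (ler_norm _) _; apply: le_trans (Re_le_normc _) _.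
  rewrite (normcM _ (g w)) (normcM c%:C) normc_real ger0_norm// -mulrA ler_wpM2l//.
  by apply: ler_piMl => //; exact: normc_ge0.
Qed.

(** Around q the exponent k (Re z)^2 equals its value at q plus Re (t z) plus (k / 2) |z - q|^2,
    with t holomorphic. At a local maximum the minorant H times exp t would therefore have the decay
    excluded by [no_strict_max]. *)
Lemma supported_no_max m q (k : R) : 0 < k -> supported m q -> 0 < m q ->
  ~ cnear q (fun z => m z * expR (k * Re z ^+ 2) <= m q * expR (k * Re q ^+ 2)).
Proof.
move=> k0 [H [Hh Hq Hn]] mq0 M.
pose t z := (2 * k * Re q)%:C * (z - q) + (k / 2)%:C * (z - q) ^+ 2.
pose G z := H z * cexp (t z).
have tq : t q = 0 by rewrite /t subrr expr0n !mulr0 addr0.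
have Gq : normc (G q) = m q by rewrite /G normcM tq cexp0 normc1 mulr1.
apply: (@no_strict_max R G q (k / 2)); first lra.
- apply: choloM Hh _; apply: (@cholo_comp t (@cexp R)); last exact: cholo_cexp.
  have hB : cholo (fun w => w - q) q by apply: choloD (cholo_id _) (cholo_cst _ _).
  apply: choloD; apply: choloM (cholo_cst _ _) _ => //.
  exact: choloX.
- by rewrite -normc_gt0 Gq.
apply: cnear_mono (cnearI M Hn) => z [{}M {}Hn].
rewrite Gq /G normcM normc_cexp.
have Rt : Re (t z) = 2 * k * Re q * (Re z - Re q) +
    k / 2 * ((Re z - Re q) ^+ 2 - (Im z - Im q) ^+ 2).
  by rewrite /t; case: (z) => ? ?; case: (q) => ? ? /=; ring.
apply: le_trans (_ : m z * expR (Re (t z)) <= _); first by rewrite ler_wpM2r ?expR_ge0.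
rewrite -(ler_pM2r (expR_gt0 (k * Re z ^+ 2))) mulrAC.
apply: le_trans (_ : m q * expR (k * Re q ^+ 2) * expR (Re (t z)) <= _).
  by rewrite ler_wpM2r ?expR_ge0.
rewrite -!mulrA -!expRD (ler_pM2l mq0) ler_expR normc_sqr !raddfB/= Rt.
by rewrite le_eqVlt; apply/orP; left; apply/eqP; field.
Qed.

Lemma in_rect_near a b c d z : a < Re z -> Re z < b -> c < Im z -> Im z < d ->
  cnear z (in_rect a b c d).
Proof.
move=> h1 h2 h3 h4.
exists (Num.min (Num.min (Re z - a) (b - Re z)) (Num.min (Im z - c) (d - Im z))).
  by rewrite !lt_min !subr_gt0 h1 h2 h3 h4.
move=> w; rewrite !lt_min => /andP[/andP[k1 k2] /andP[k3 k4]].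
have := Re_le_normc (w - z); have := Im_le_normc (w - z).
by rewrite !raddfB/= !ler_norml => /andP[i1 i2] /andP[r1 r2]; split; lra.
Qed.

(* The maxima on A are taken as a hypothesis, so that A may be a vertical strip
   on which m is periodic. *)
Lemma max_principle_gen m (A bd : set R[i]) (X B : R) : 0 <= B ->
  (forall z, A z -> `|Re z| <= X) ->
  (forall k : R, exists2 q, A q & forall z, A z ->
     m z * expR (k * Re z ^+ 2) <= m q * expR (k * Re q ^+ 2)) ->
  (forall z, A z -> ~ bd z -> cnear z A /\ supported m z) ->
  (forall z, A z -> bd z -> m z <= B) ->
  forall z, A z -> m z <= B.
Proof.
move=> B0 AX Amax Aint mB z0 z0in; rewrite leNgt; apply/negP => Bm.
pose B1 := (B + m z0) / 2.
have B10 : 0 < B1 by rewrite /B1; lra.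
have B1m : 1 < m z0 / B1 by rewrite ltr_pdivlMr// mul1r /B1; lra.
have X0 : 0 < X ^+ 2 + 1 by have := sqr_ge0 X; lra.
(* With this k the weight is at most m z0 / B1 on A, and B < B1, so it cannot raise a boundary value
   to m z0. The + 1 keeps the quotient meaningful for X = 0. *)
pose k := ln (m z0 / B1) / (X ^+ 2 + 1).
have k0 : 0 < k by rewrite divr_gt0// ln_gt0.
have small x : `|x| <= X -> B * expR (k * x ^+ 2) < m z0.
  move=> xX.
  have x2 : x ^+ 2 <= X ^+ 2.
    by rewrite -real_normK ?num_real// ler_pXn2r ?nnegrE ?(le_trans _ xX).
  apply: (@le_lt_trans _ _ (B * (m z0 / B1))); last first.
    by rewrite mulrA ltr_pdivrMr// mulrC ltr_pM2l ?(le_lt_trans B0 Bm)// /B1; lra.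
  apply: ler_wpM2l => //; rewrite -[leRHS]lnK ?posrE ?(lt_trans _ B1m)//.
  rewrite ler_expR /k mulrAC ler_pdivrMr// ler_pM2l ?ln_gt0//; lra.
have [q qin qmax] := Amax k.
have qz : m z0 <= m q * expR (k * Re q ^+ 2).
  apply: le_trans (qmax _ z0in); rewrite ler_peMr ?(ltW (le_lt_trans B0 Bm))//.
  by rewrite -expR0 ler_expR mulr_ge0 ?sqr_ge0 ?(ltW k0).
have nb : ~ bd q.
  move=> /(mB _ qin) mqB.
  have := small _ (AX _ qin); rewrite ltNge => /negP; apply; apply: le_trans qz _.
  by rewrite ler_wpM2r ?expR_ge0.
have mq0 : 0 < m q.
  by have := lt_le_trans (le_lt_trans B0 Bm) qz; rewrite pmulr_lgt0 ?expR_gt0.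
have [qA sq] := Aint _ qin nb.
by apply: (supported_no_max k0 sq mq0); apply: cnear_mono qA => z /qmax.
Qed.

Lemma ccont_weight m z (k : R) : ccont m z ->
  ccont (fun z => m z * expR (k * Re z ^+ 2)) z.
Proof.
move=> mz; apply: ccontM => //.
apply: (ccont_comp (phi := expR)); first exact: continuous_expR.
by apply: ccontM (ccont_cst _ _) _; apply: ccontM; exact: ccont_Re.
Qed.

Lemma max_principle m a b c d (B : R) : 0 <= B ->
  (forall z, in_rect a b c d z -> ccont m z) ->
  (forall z, a < Re z -> Re z < b -> c < Im z -> Im z < d -> supported m z) ->
  (forall z, in_rect a b c d z ->
     [\/ Re z = a, Re z = b, Im z = c | Im z = d] -> m z <= B) ->
  forall z, in_rect a b c d z -> m z <= B.
Proof.
move=> B0 mc ms mB z0 z0in.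
have ab : a <= b by case: z0in => *; lra.
have cd : c <= d by case: z0in => *; lra.
apply: (@max_principle_gen m (in_rect a b c d)
  (fun z => [\/ Re z = a, Re z = b, Im z = c | Im z = d]) (`|a| + `|b|)) => //.
- move=> z [h1 h2 _ _].
  have := ler_norm b; have := ler_norm (- a); have := normr_ge0 a; have := normr_ge0 b.
  by rewrite normrN ler_norml => *; apply/andP; split; lra.
- move=> k; apply: (rect_EVT (T := fun z => m z * expR (k * Re z ^+ 2))) => // z zin.
  exact: ccont_weight (mc _ zin).
- move=> q qin nb.
  have [q1 q2 q3 q4] : [/\ a < Re q, Re q < b, c < Im q & Im q < d].
    case: (qin) => q1 q2 q3 q4; split; rewrite lt_neqAle ?q1 ?q2 ?q3 ?q4 andbT;
    apply/eqP => E; apply: nb; [exact: Or41|exact: Or42|exact: Or43|exact: Or44].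
  by split; [exact: in_rect_near|exact: ms].
Qed.

End Subharmonic.

(** * Squares that cannot meet the complement, and rigidity of F *)

Section Containment.
Context {R : realType}.
Implicit Types (F : R[i] -> R[i]) (z c : R[i]) (d e r : R).

Definition in_square c r z := `|Re (z - c)| <= r /\ `|Im (z - c)| <= r.

Lemma in_squareE c r z : in_square c r z <->
  in_rect (Re c - r) (Re c + r) (Im c - r) (Im c + r) z.
Proof.
rewrite /in_square /in_rect !raddfB/= !ler_norml; split.
  by move=> [/andP[? ?] /andP[? ?]]; split; lra.
by move=> [? ? ? ?]; split; apply/andP; split; lra.
Qed.

Lemma in_square_normc c r z : in_square c r z -> normc (z - c) <= 2 * r.
Proof. by move=> [h1 h2]; apply: le_trans (normc_le_ReIm _) _; lra. Qed.

Lemma in_square_center c r : 0 <= r -> in_square c r c.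
Proof. by move=> r0; rewrite /in_square subrr/= normr0. Qed.

Lemma in_squareW c r r' z : r <= r' -> in_square c r z -> in_square c r' z.
Proof. by move=> rr [h1 h2]; split; exact: le_trans rr. Qed.

Lemma square_boundary c r z : in_square c r z ->
  [\/ Re z = Re c - r, Re z = Re c + r, Im z = Im c - r | Im z = Im c + r] ->
  `|Re (z - c)| = r \/ `|Im (z - c)| = r.
Proof.
move=> [h1 h2]; have r0 := le_trans (normr_ge0 _) h1.
rewrite !raddfB/=; case=> ->; rewrite [_ + _ - _]addrC ?addrA ?addNr ?add0r ?normrN;
  by [left; rewrite ger0_norm|right; rewrite ger0_norm].
Qed.

Lemma max_principle_square (m : R[i] -> R) c r B : 0 <= B ->
  (forall z, in_square c r z -> ccont m z) ->
  (forall z, in_square c r z -> supported m z) ->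
  (forall z, in_square c r z ->
     `|Re (z - c)| = r \/ `|Im (z - c)| = r -> m z <= B) ->
  forall z, in_square c r z -> m z <= B.
Proof.
move=> B0 mc ms mB z /in_squareE.
apply: max_principle => //.
- by move=> u /in_squareE; exact: mc.
- by move=> u h1 h2 h3 h4; apply: ms; apply/in_squareE; split; exact: ltW.
- by move=> u /in_squareE h /(square_boundary h); exact: mB.
Qed.

Lemma expR1_le4 : expR 1 <= 4 :> R.
Proof.
have h : 1 / 2 <= expR (- (1 / 2)) :> R by have := expR_ge1Dx (- (1 / 2) : R); lra.
have h2 : expR (1 / 2) <= 2 :> R.
  rewrite -[leLHS]invrK -expRN -[leRHS]invrK lef_pV2 ?posrE ?expR_gt0//; lra.
have -> : 1 = 1 / 2 + 1 / 2 :> R by field.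
rewrite expRD; have p := expR_gt0 (1 / 2 : R).
have : expR (1 / 2) * expR (1 / 2) <= 2 * 2 :> R by apply: ler_pM => //; exact: ltW.
lra.
Qed.

(* The factor exp (32 |F|) makes |F - F p| exp (32 |F|) minimal near F = 0, where it
   is replaced by a constant; 32 and 40 only have to be large enough. *)
Lemma complement_far (U : set R[i]) F c d : 0 < d ->
  (forall z, U z -> cnear z U) ->
  (forall z, U z -> cholo F z) ->
  U c -> F c = 1 ->
  (forall z, in_square c (40 * d) z -> U z -> normc (F z) <= 1 + 1 / 64) ->
  (forall z, in_square c (40 * d) z -> ~ U z ->
     cnear z (fun w => U w -> normc (F w) < 1 / 64)) ->
  forall z, in_square c d z -> U z.
Proof.
move=> d0 Uo FU Uc Fc1 Fle Fsmall w win; apply: contrapT => Uw.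
have sq40 z : in_square c d z -> in_square c (40 * d) z by apply: in_squareW; lra.
(* The cutoff 1/16 lies above the bound 1/64 near the complement, so n is continuous across it.
   Along the segment from c to w it falls from 1 to 1/16; the intermediate value 1/4 exceeds the
   cutoff and is thus a value of |F| at a point of U. *)
pose n z := if `[< U z >] then Num.max (normc (F z)) (1 / 16) else 1 / 16.
have nc z : in_square c (40 * d) z -> ccont n z.
  move=> zin; have [Uz|Uz] := pselect (U z).
    apply: (@ccont_ext _ (fun u => Num.max (normc (F u)) (1 / 16))).
      by apply: cnear_mono (Uo _ Uz) => u Uu; rewrite /n asboolT.
    by apply: ccont_max (ccont_cst _ _); exact: cholo_cont (FU _ Uz).
  apply: (@ccont_ext _ (fun u => 1 / 16)); last exact: ccont_cst.
  apply: cnear_mono (Fsmall _ zin Uz) => u Fu; rewrite /n; case: asboolP => // Uu.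
  by rewrite max_r//; have := Fu Uu; lra.
pose path (t : R) := c + t%:C * (w - c).
have pathin t : 0 <= t -> t <= 1 -> in_square c d (path t).
  move=> t0 t1; case: win => h1 h2.
  rewrite /in_square /path addrC addKr.
  have -> : Re (t%:C * (w - c)) = t * Re (w - c) by case: (w - c) => ? ? /=; ring.
  have -> : Im (t%:C * (w - c)) = t * Im (w - c) by case: (w - c) => ? ? /=; ring.
  by split; rewrite normrM (ger0_norm t0) -[leRHS]mul1r ler_pM.
have [p [pin Up Fp]] : exists p, [/\ in_square c d p, U p & normc (F p) = 1 / 4].
  have ncont : {within `[0, 1], continuous (fun t => n (path t))}.
    apply: continuous_in_subspaceT => t; rewrite inE/= in_itv/= => /andP[t0 t1].
    apply/cvgrPdist_lt => e e0.
    have [dl dl0 hd] := nc _ (sq40 _ (pathin t t0 t1)) e e0.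
    have p0 : 0 < normc (w - c) + 1 by have := normc_ge0 (w - c); lra.
    have q0 : 0 < dl / (normc (w - c) + 1) by rewrite divr_gt0.
    near=> u; rewrite distrC; apply: hd.
    have -> : path u - path t = (u - t)%:C * (w - c) by rewrite /path rmorphB; ring.
    rewrite normcM normc_real.
    apply: (@le_lt_trans _ _ (`|u - t| * (normc (w - c) + 1))).
      by rewrite ler_wpM2l//; lra.
    rewrite -ltr_pdivlMr// distrC; near: u.
  have := @IVT R (fun t => n (path t)) 0 1 (1 / 4) ler01 ncont.
  have -> : n (path 0) = 1.
    have -> : path 0 = c by rewrite /path rmorph0; ring.
    by rewrite /n asboolT// Fc1 normc1 max_l//; lra.
  have -> : n (path 1) = 1 / 16.
    have -> : path 1 = w by rewrite /path rmorph1; ring.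
    by rewrite /n asboolF.
  case; first by rewrite ge_min le_max; apply/andP; split; apply/orP; [right|left]; lra.
  move=> t; rewrite in_itv/= => /andP[t0 t1] nt.
  exists (path t); split; first exact: pathin.
    by move: nt; rewrite /n; case: asboolP => // _; lra.
  move: nt; rewrite /n; case: asboolP => [_|_]; last by lra.
  rewrite /Num.max; case: ifP => _; lra.
pose v := F p; pose E1 z := normc (F z - v) * expR (32 * normc (F z)).
(* For |F| < 1/64 one has |F - v| <= 1/64 + 1/4 and 32 |F| <= 1/2, so [e0] dominates [E1]. For 1/16
   < |F| < 1/8, conversely, [E1] is at least exp 2 / 8, which exceeds [e0]. The branches of [E]
   therefore agree on an overlap. *)
pose e0 := 17 / 64 * expR (1 / 2) : R.
have e00 : 0 < e0 by rewrite mulr_gt0 ?expR_gt0//; lra.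
pose E z := if `[< U z >] then
  (if normc (F z) < 1 / 8 then Num.max (E1 z) e0 else E1 z) else e0.
have E_out z : in_square c (40 * d) z -> ~ U z -> cnear z (fun u => E u = e0).
  move=> zin Uz; apply: cnear_mono (Fsmall _ zin Uz) => u Fu; rewrite /E.
  case: asboolP => // /Fu {}Fu; rewrite ifT; last by lra.
  apply: max_r; apply: ler_pM; rewrite ?normc_ge0 ?expR_ge0//.
    by apply: le_trans (le_normcD _ _) _; rewrite normcN Fp; lra.
  by rewrite ler_expR; lra.
have E_low z : U z -> normc (F z) < 1 / 8 -> cnear z (fun u => E u = Num.max (E1 u) e0).
  move=> Uz Fz; apply: cnear_mono (cnearI (Uo _ Uz) (ccont_lt (cholo_cont (FU _ Uz)) Fz)).
  by move=> u [Uu Fu]; rewrite /E asboolT// Fu.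
have E_high z : U z -> 1 / 16 < normc (F z) -> cnear z (fun u => E u = E1 u).
  move=> Uz Fz; apply: cnear_mono (cnearI (Uo _ Uz) (ccont_gt (cholo_cont (FU _ Uz)) Fz)).
  move=> u [Uu Fu]; rewrite /E asboolT//; case: ifP => // F8; apply: max_l.
  apply: (@le_trans _ _ (1 / 8 * expR 2)).
    have -> : 2 = 3 / 2 + 1 / 2 :> R by field.
    rewrite expRD mulrA ler_pM2r ?expR_gt0//.
    by have := expR_ge1Dx (3 / 2 : R); lra.
  apply: ler_pM => //; rewrite ?expR_ge0//; last by rewrite ler_expR; lra.
  have := normc_ge_sub v (F u); rewrite normcB Fp; lra.
have hol1 z : U z -> cholo (fun u => F u - v) z.
  by move=> Uz; exact: choloD (FU _ Uz) (cholo_cst _ _).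
have E1c z : U z -> ccont E1 z.
  move=> Uz; apply: ccontM; first exact: (cholo_cont (hol1 _ Uz)).
  apply: (ccont_comp (phi := expR)); first exact: continuous_expR.
  by apply: ccontM (ccont_cst _ _) _; exact: cholo_cont (FU _ Uz).
have E1s z : U z -> supported E1 z.
  move=> Uz; apply: supportedM; first exact: (supported_normc (hol1 _ Uz)).
  by apply: supported_expR_normc => //; exact: FU.
have cases z : in_square c (40 * d) z -> [\/ cnear z (fun u => E u = e0),
    U z /\ cnear z (fun u => E u = Num.max (E1 u) e0) |
    U z /\ cnear z (fun u => E u = E1 u)].
  move=> zin; have [Uz|Uz] := pselect (U z); last by apply: Or31; exact: E_out.
  case: (ltP (normc (F z)) (1 / 8)) => Fz; first by apply: Or32; split=> //; exact: E_low.
  by apply: Or33; split=> //; apply: E_high => //; lra.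
have Ec z : in_square c (40 * d) z -> ccont E z.
  move=> /cases[h|[Uz h]|[Uz h]].
  - by apply: ccont_ext (ccont_cst e0 z); apply: cnear_mono h.
  - by apply: ccont_ext (ccont_max (E1c _ Uz) (ccont_cst e0 z)); apply: cnear_mono h.
  - by apply: ccont_ext (E1c _ Uz); apply: cnear_mono h.
have Es z : in_square c (40 * d) z -> supported E z.
  move=> /cases[h|[Uz h]|[Uz h]].
  - apply: supported_below (supported_cst z (ltW e00)); last by rewrite (cnear_self h).
    by apply: cnear_mono h => u ->.
  - have Ez := cnear_self h.
    have [m1|m1] := leP e0 (E1 z).
      apply: supported_below (E1s _ Uz); last by rewrite Ez max_l.
      by apply: cnear_mono h => u ->; rewrite le_max lexx.
    apply: supported_below (supported_cst z (ltW e00)); last by rewrite Ez max_r// ltW.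
    by apply: cnear_mono h => u ->; rewrite le_max lexx orbT.
  - apply: supported_below (E1s _ Uz); last by rewrite (cnear_self h).
    by apply: cnear_mono h => u ->.
have E0 z : 0 <= E z.
  rewrite /E; case: asboolP => // _; last exact: ltW.
  have h : 0 <= E1 z by rewrite mulr_ge0 ?normc_ge0 ?expR_ge0.
  by case: ifP => // _; rewrite le_max h.
(* Here 81/64 = 1 + 1/64 + 1/4 bounds |F - v|, and 32 + 1/2 = 32 (1 + 1/64). *)
pose B := 81 / 64 * expR (32 + 1 / 2) : R.
have e0B : e0 <= B.
  by apply: ler_pM; rewrite ?expR_ge0 ?ler_expR//; lra.
have EB z : in_square c (40 * d) z -> E z <= B.
  move=> zin; rewrite /E; case: asboolP => // Uz.
  have h : E1 z <= B.
    have Fz := Fle _ zin Uz.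
    apply: ler_pM; rewrite ?normc_ge0 ?expR_ge0//; last by rewrite ler_expR; lra.
    by apply: le_trans (le_normcD _ _) _; rewrite normcN Fp; lra.
  by case: ifP => // _; rewrite ge_max h e0B.
have B0 : 0 <= B := le_trans (ltW e00) e0B.
(* As E vanishes to first order at p, dividing its square by |z - p| leaves a zero there: m is
   continuous at p with the value 0 that the convention 0^-1 = 0 assigns. *)
pose m z := E z * E z * normc ((z - p)^-1).
have mp : m p = 0 by rewrite /m subrr invr0 normc0 mulr0.
have m0 z : 0 <= m z by rewrite !mulr_ge0 ?normc_ge0.
have hinv z : z != p -> cholo (fun u => (u - p)^-1) z.
  move=> zp; apply: choloV; last by rewrite subr_eq0.
  exact: choloD (cholo_id _) (cholo_cst _ _).
have p40 := sq40 _ pin.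
have mc z : in_square c (40 * d) z -> ccont m z.
  move=> zin; have [->|zp] := eqVneq z p; last first.
    by apply: ccontM; [apply: ccontM; exact: Ec|exact: cholo_cont (hinv _ zp)].
  move=> e ee.
  have [l hl] := cnear_self (FU _ Up).
  have F1 : normc (F p) < 1 by rewrite Fp; lra.
  have F16 : 1 / 16 < normc (F p) by rewrite Fp; lra.
  pose X := (normc l + 1) * expR 32.
  have X0 : 0 < X by rewrite mulr_gt0 ?expR_gt0//; have := normc_ge0 l; lra.
  have nr : cnear p (fun u => normc (u - p) < e / X ^+ 2).
    by exists (e / X ^+ 2) => //; rewrite divr_gt0// exprn_gt0.
  have := cnearI (cnearI (cderiv_near_bound hl) (ccont_lt (cholo_cont (FU _ Up)) F1))
    (cnearI (E_high _ Up F16) nr).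
  apply: cnear_mono => u [[b1 b2] [b3 b4]].
  rewrite mp subr0 ger0_norm//.
  have [->|up] := eqVneq u p; first by rewrite mp.
  have n0 : 0 < normc (u - p) by rewrite normc_gt0 subr_eq0.
  have Eu : E u <= X * normc (u - p).
    rewrite b3 /E1 /X mulrAC; apply: ler_pM; rewrite ?normc_ge0 ?expR_ge0//.
    by rewrite ler_expR; lra.
  rewrite /m normcV ltr_pdivrMr//.
  apply: le_lt_trans (ler_pM (E0 u) (E0 u) Eu Eu) _.
  have -> : X * normc (u - p) * (X * normc (u - p)) =
    X ^+ 2 * normc (u - p) * normc (u - p) by ring.
  by rewrite ltr_pM2r// mulrC -ltr_pdivlMr// exprn_gt0.
have ms z : in_square c (40 * d) z -> supported m z.
  move=> zin; have [->|zp] := eqVneq z p.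
    apply: supported_below (supported_cst p (lexx 0)); last by rewrite mp.
    by exists 1 => // u _; exact: m0.
  by apply: supportedM (supported_normc (hinv _ zp)); apply: supportedM; exact: Es.
have d39 : 0 < 39 * d by lra.
have mB z : in_square c (40 * d) z ->
    `|Re (z - c)| = 40 * d \/ `|Im (z - c)| = 40 * d -> m z <= B * B / (39 * d).
  move=> zin bd; apply: ler_pM; rewrite ?normc_ge0 ?mulr_ge0//.
    by apply: ler_pM => //; exact: EB.
  have far : 39 * d <= normc (z - p).
    case: pin => pin1 pin2; case: bd => bd.
      apply: le_trans (Re_le_normc _).
      have -> : z - p = (z - c) - (p - c) by ring.
      rewrite raddfB; apply: le_trans (lerB_dist _ _); rewrite bd.
      by move: pin1 => /=; lra.
    apply: le_trans (Im_le_normc _).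
    have -> : z - p = (z - c) - (p - c) by ring.
    rewrite raddfB; apply: le_trans (lerB_dist _ _); rewrite bd.
    by move: pin2 => /=; lra.
  by rewrite normcV lef_pV2 ?posrE ?(lt_le_trans d39 far).
have B2 : 0 <= B * B / (39 * d) by apply: divr_ge0; [exact: mulr_ge0|exact: ltW].
have c40 : in_square c (40 * d) c by apply: in_square_center; lra.
have := max_principle_square B2 mc ms mB c40.
have cp : 0 < normc (c - p).
  rewrite normc_gt0 subr_eq0; apply/eqP => cp.
  by have := Fp; rewrite -cp Fc1 normc1; lra.
have Ecc : 3 / 4 * expR 32 <= E c.
  rewrite /E asboolT// Fc1 normc1 ifF; last by apply/negbTE; rewrite -leNgt; lra.
  rewrite /E1 Fc1 normc1 mulr1 ler_pM2r ?expR_gt0//.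
  by have := normc_ge_sub 1 v; rewrite normc1 Fp; lra.
have cp2 : normc (c - p) <= 2 * d by rewrite normcB; exact: in_square_normc.
(* The maximum principle gives E(c)^2 <= B^2 (2 d) / (39 d), which is less than exp(64) / 3, whereas
   E(c)^2 is at least 9/16 exp(64). *)
rewrite /m normcV ler_pdivrMr// leNgt => /negP; apply.
have L : 3 / 4 * expR 32 * (3 / 4 * expR 32) <= E c * E c.
  by apply: ler_pM => //; rewrite mulr_ge0 ?expR_ge0//; lra.
apply: lt_le_trans L.
apply: (@le_lt_trans _ _ (B * B / (39 * d) * (2 * d))); first by rewrite ler_wpM2l.
have -> : B * B / (39 * d) * (2 * d) = 81 * 81 * 2 / (64 * 64 * 39) * expR 1 * (expR 32 * expR 32).
  have -> : expR 1 = expR (1 / 2) * expR (1 / 2) :> R by rewrite -expRD; congr expR; field.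
  by rewrite /B expRD; field; rewrite gt_eqF.
rewrite (_ : 3 / 4 * expR 32 * (3 / 4 * expR 32) = 9 / 16 * (expR 32 * expR 32)); last by field.
rewrite (ltr_pM2r (mulr_gt0 (expR_gt0 _) (expR_gt0 _))).
by have := expR1_le4; lra.
Unshelve. all: by end_near. Qed.

(** Since Re (F - 1) <= e, the Moebius image Q = (F - 1) / (2 e - (F - 1)) has modulus at most 1 and
    vanishes at c. A weak Schwarz lemma, from |Q|^2 / |z - c|, suffices: the ratio 8 of the squares
    yields |Q|^2 <= 2 / 8, and |Q| <= 1/2 means |F - 1| <= 2 e. *)
Lemma borel_caratheodory F c d e : 0 < d -> 0 < e ->
  (forall z, in_square c (8 * d) z -> cholo F z) -> F c = 1 ->
  (forall z, in_square c (8 * d) z -> normc (F z) <= 1 + e) ->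
  forall z, in_square c d z -> normc (F z - 1) <= 2 * e.
Proof.
move=> d0 e0 FH Fc Fle z0 z0in.
pose Q z := (F z - 1) / ((2 * e)%:C - (F z - 1)).
have Rw z : in_square c (8 * d) z -> Re (F z - 1) <= e.
  move=> zin; rewrite raddfB/=; have := Fle _ zin.
  by have := le_trans (ler_norm _) (Re_le_normc (F z)); lra.
have den z : in_square c (8 * d) z -> (2 * e)%:C - (F z - 1) != 0.
  move=> /Rw h; apply/eqP => /(congr1 (@complex.Re R)); rewrite raddfB/= => h2.
  by move: h h2; rewrite /=; lra.
have Qle z : in_square c (8 * d) z -> normc (Q z) <= 1.
  move=> zin; rewrite /Q normcM normcV ler_pdivrMr ?normc_gt0 ?den// mul1r.
  rewrite -(@ler_pXn2r _ 2) ?nnegrE ?normc_ge0// !normc_sqr.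
  have h := Rw _ zin; move: h; case: (F z - 1) => x y /= h.
  by rewrite sub0r sqrrN lerD2r; nra.
have Qh z : in_square c (8 * d) z -> cholo Q z.
  move=> zin; have h1 : cholo (fun u => F u - 1) z.
    by apply: choloD (FH _ zin) (cholo_cst _ _).
  apply: choloM => //; apply: choloV; last exact: den.
  apply: choloD (cholo_cst _ _) _.
  have := choloM (cholo_cst (-1) z) h1.
  by apply: cnear_mono => u [l hl]; exists l; apply: cderiv_ext hl; exists 1 => // x _; ring.
have Qc : Q c = 0 by rewrite /Q Fc subrr mul0r.
have d8 : 0 < 8 * d by lra.
have c8 : in_square c (8 * d) c by apply: in_square_center; lra.
pose m z := normc (Q z) * normc (Q z) * normc ((z - c)^-1).
have mc0 : m c = 0 by rewrite /m Qc normc0 !mul0r.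
have m0 z : 0 <= m z by rewrite !mulr_ge0 ?normc_ge0.
have hinv z : z != c -> cholo (fun u => (u - c)^-1) z.
  move=> zp; apply: choloV; last by rewrite subr_eq0.
  exact: choloD (cholo_id _) (cholo_cst _ _).
have mc z : in_square c (8 * d) z -> ccont m z.
  move=> zin; have [->|zp] := eqVneq z c; last first.
    by apply: ccontM; [apply: ccontM; exact: cholo_cont (Qh _ zin)|exact: cholo_cont (hinv _ zp)].
  move=> t t0.
  have [l hl] := cnear_self (Qh _ c8).
  pose X := normc l + 1.
  have X0 : 0 < X by rewrite /X; have := normc_ge0 l; lra.
  have nr : cnear c (fun u => normc (u - c) < t / X ^+ 2).
    by exists (t / X ^+ 2) => //; rewrite divr_gt0// exprn_gt0.
  apply: cnear_mono (cnearI (cderiv_near_bound hl) nr) => u [].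
  rewrite Qc subr0 => b1 b2; rewrite mc0 subr0 ger0_norm//.
  have [->|up] := eqVneq u c; first by rewrite mc0.
  have n0 : 0 < normc (u - c) by rewrite normc_gt0 subr_eq0.
  rewrite /m normcV ltr_pdivrMr//.
  apply: le_lt_trans (ler_pM (normc_ge0 _) (normc_ge0 _) b1 b1) _.
  have -> : X * normc (u - c) * (X * normc (u - c)) =
    X ^+ 2 * normc (u - c) * normc (u - c) by ring.
  by rewrite ltr_pM2r// mulrC -ltr_pdivlMr// exprn_gt0.
have ms z : in_square c (8 * d) z -> supported m z.
  move=> zin; have [->|zp] := eqVneq z c.
    apply: supported_below (supported_cst c (lexx 0)); last by rewrite mc0.
    by exists 1 => // u _; exact: m0.
  apply: supportedM (supported_normc (hinv _ zp)).
  by apply: supportedM; exact: supported_normc (Qh _ zin).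
have mB z : in_square c (8 * d) z ->
    `|Re (z - c)| = 8 * d \/ `|Im (z - c)| = 8 * d -> m z <= (8 * d)^-1.
  move=> zin bd; rewrite -[leRHS]mul1r; apply: ler_pM; rewrite ?normc_ge0 ?mulr_ge0 ?normc_ge0//.
    by rewrite -[leRHS]mulr1; apply: ler_pM; rewrite ?normc_ge0 ?Qle.
  have far : 8 * d <= normc (z - c).
    by case: bd => <-; [exact: Re_le_normc|exact: Im_le_normc].
  by rewrite normcV lef_pV2 ?posrE ?(lt_le_trans d8 far).
have z8 : in_square c (8 * d) z0 by apply: in_squareW z0in; lra.
have [->|zc] := eqVneq z0 c; first by rewrite Fc subrr normc0; lra.
have n0 : 0 < normc (z0 - c) by rewrite normc_gt0 subr_eq0.
have i8 : 0 <= (8 * d)^-1 by rewrite invr_ge0; lra.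
have := max_principle_square i8 mc ms mB z8.
rewrite /m normcV ler_pdivrMr// => h.
have zc2 := in_square_normc z0in.
have q4 : normc (Q z0) ^+ 2 <= (1 / 2) ^+ 2.
  rewrite expr2; apply: le_trans h _.
  apply: (@le_trans _ _ ((8 * d)^-1 * (2 * d))); first by rewrite ler_wpM2l.
  by rewrite le_eqVlt; apply/orP; left; apply/eqP; field; rewrite gt_eqF.
have q2 : normc (Q z0) <= 1 / 2.
  by move: q4; rewrite ler_pXn2r ?nnegrE ?normc_ge0//; lra.
have E : F z0 - 1 = Q z0 * ((2 * e)%:C - (F z0 - 1)) by rewrite /Q divfK ?den.
have : normc (F z0 - 1) <= 1 / 2 * (2 * e + normc (F z0 - 1)).
  rewrite {1}E normcM; apply: ler_pM; rewrite ?normc_ge0//.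
  apply: le_trans (le_normcD _ _) _; rewrite normcN normc_real ger0_norm//; lra.
by lra.
Qed.

(** Containment is needed on the whole square of half side 8 d used by the Borel-Caratheodory
    inequality, hence 320 = 40 * 8. *)
Lemma rigidity (U : set R[i]) F c d e : 0 < d -> 0 < e -> e <= 1 / 64 ->
  (forall z, U z -> cnear z U) ->
  (forall z, U z -> cholo F z) ->
  U c -> F c = 1 ->
  (forall z, in_square c (320 * d) z -> U z -> normc (F z) <= 1 + e) ->
  (forall z, in_square c (320 * d) z -> ~ U z ->
     cnear z (fun w => U w -> normc (F w) < 1 / 64)) ->
  forall z, in_square c d z -> U z /\ normc (F z - 1) <= 2 * e.
Proof.
move=> d0 e0 e64 Uo FU Uc Fc Fle Fs.
have E8 : 40 * (8 * d) = 320 * d by ring.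
have U8 z : in_square c (8 * d) z -> U z.
  apply: (@complement_far U F c (8 * d)) => //; rewrite ?E8 //; first lra.
  by move=> u uin Uu; apply: le_trans (Fle u uin Uu) _; lra.
move=> z zin; split; first by apply: U8; apply: in_squareW zin; lra.
apply: (@borel_caratheodory F c d e) => // u u8; first exact: FU (U8 _ u8).
by apply: Fle (U8 _ u8); apply: in_squareW u8; lra.
Qed.

End Containment.

(** * Convex functions of a real variable and their right slopes *)

Section ConvexFunctions.
Context {R : realType} (Phi : R -> R).
Implicit Types (x y h k : R).

(** Convexity in terms of affine majorants at two points: this is the form in which a maximum
    principle delivers it, and no convex combinations appear. *)
Definition convex_chord := forall x1 x2 al c x, x1 <= x -> x <= x2 ->
  Phi x1 <= al * x1 + c -> Phi x2 <= al * x2 + c -> Phi x <= al * x + c.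

(** For a convex function the quotients decrease with h, so this infimum is the right derivative,
    obtained without a limit. *)
Definition right_slope x : R :=
  inf [set (Phi (x + h) - Phi x) / h | h in [set h : R | 0 < h]].

Context (cvx : convex_chord).

Lemma slope_nondecr x h k : 0 < h -> h <= k ->
  (Phi (x + h) - Phi x) / h <= (Phi (x + k) - Phi x) / k.
Proof.
move=> h0 hk; have k0 := lt_le_trans h0 hk.
set al := (_ / k); rewrite ler_pdivrMr//.
have E : al * k = Phi (x + k) - Phi x by rewrite divfK ?gt_eqF.
have H : Phi (x + h) <= al * (x + h) + (Phi x - al * x).
  by apply: (@cvx x (x + k)); lra.
by lra.
Qed.

Lemma slope_left_right x h k : 0 < h -> 0 < k ->
  (Phi x - Phi (x - k)) / k <= (Phi (x + h) - Phi x) / h.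
Proof.
move=> h0 k0; pose al := (Phi (x + h) - Phi (x - k)) / (h + k).
have hk : 0 < h + k by lra.
have E : al * (h + k) = Phi (x + h) - Phi (x - k) by rewrite divfK ?gt_eqF.
have H : Phi x <= al * x + (Phi (x - k) - al * (x - k)).
  by apply: (@cvx (x - k) (x + h)); lra.
apply: (@le_trans _ _ al); first by rewrite ler_pdivrMr//; lra.
by rewrite ler_pdivlMr//; lra.
Qed.

Lemma right_slope_has_inf x :
  has_inf [set (Phi (x + h) - Phi x) / h | h in [set h : R | 0 < h]].
Proof.
split; first by exists ((Phi (x + 1) - Phi x) / 1); exists 1 => //=; exact: ltr01.
exists ((Phi x - Phi (x - 1)) / 1) => _ [h /= h0 <-].
exact: slope_left_right.
Qed.

Lemma right_slope_support x y : Phi x + right_slope x * (y - x) <= Phi y.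
Proof.
case: (ltgtP x y) => [xy|yx|->]; last by rewrite subrr mulr0 addr0.
  have h0 : 0 < y - x by lra.
  rewrite addrC -lerBrDr -ler_pdivlMr//.
  apply: ge_inf; first by case: (right_slope_has_inf x).
  by exists (y - x) => //; congr ((Phi _ - _) / _); ring.
have k0 : 0 < x - y by lra.
have : (Phi x - Phi y) / (x - y) <= right_slope x.
  apply: lb_le_inf; first by case: (right_slope_has_inf x).
  move=> _ [h /= h0 <-].
  have := slope_left_right x h0 k0.
  by rewrite (_ : x - (x - y) = y)//; ring.
by rewrite ler_pdivrMr//; lra.
Qed.

Lemma right_slope_nondecr x y : x <= y -> right_slope x <= right_slope y.
Proof.
rewrite le_eqVlt => /orP[/eqP->//|xy].
have := right_slope_support x y; have := right_slope_support y x => h1 h2.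
have d0 : 0 < y - x by lra.
by rewrite -(ler_pM2r d0); lra.
Qed.

(** Agreement is asked only to the right of x because log M(r,f,D) coincides with [log_growth] only
    where the circle meets D, which is guaranteed from some radius on. *)
Lemma right_derivative_slope (g : R -> R) x :
  (forall y, x <= y -> g y = Phi y) -> right_derivative g x = right_slope x.
Proof.
move=> gP; apply: cvg_lim => //; apply/cvgrPdist_lt => e e0.
have := @inf_adherent _ _ e e0 (right_slope_has_inf x).
move=> [_ [k /= k0 <-]] hk; near=> h.
have h0 : 0 < h by near: h; exact: nbhs_right_gt.
have hk' : h <= k by near: h; exact: nbhs_right_le.
have -> : g (x + h) = Phi (x + h) by apply: gP; lra.
have -> : g x = Phi x by exact: gP.
have s1 := slope_nondecr x h0 hk'.
have s2 : right_slope x <= (Phi (x + h) - Phi x) / h.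
  by apply: ge_inf; [case: (right_slope_has_inf x)|exists h].
rewrite -/(right_slope x) in hk.
by rewrite distrC ger0_norm ?subr_ge0//; lra.
Unshelve. all: by end_near. Qed.

End ConvexFunctions.

(** * The extended modulus of f, its maxima on circles and their convexity *)

Section TractFunction.
Context {R : realType}.

(* The conditions of a direct tract that only concern |f| near D. *)
Definition tract_bound (f : R[i] -> R[i]) (D : set R[i]) (rho : R) :=
  [/\ 0 < rho,
      forall z, D z -> cnear z D,
      forall z, D z -> cholo f z,
      forall z, D z -> rho < normc (f z) &
      forall z, ~ D z -> forall e, 0 < e ->
        cnear z (fun w => D w -> normc (f w) < rho + e)].

Context (f : R[i] -> R[i]) (D : set R[i]) (rho : R).
Context (tract : tract_bound f D rho).

(** This is rho exp v for the subharmonic v of the overview; the multiplicative form is the one that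
    [supported] describes. *)
Definition tract_ext z := if `[< D z >] then normc (f z) else rho.

Lemma tract_ext_ge z : rho <= tract_ext z.
Proof.
case: tract => _ _ _ h _; rewrite /tract_ext.
by case: asboolP => // /h /ltW.
Qed.

Lemma tract_extE z : D z -> tract_ext z = normc (f z).
Proof. by move=> Dz; rewrite /tract_ext asboolT. Qed.

Lemma tract_ext_ccont z : ccont tract_ext z.
Proof.
case: tract => r0 Do fh fr fb.
have [Dz|nDz] := pselect (D z).
  apply: ccont_ext (cholo_cont (fh _ Dz)).
  by apply: cnear_mono (Do _ Dz) => w /tract_extE.
move=> e e0; apply: cnear_mono (fb _ nDz _ e0) => w Dw.
have := tract_ext_ge w; rewrite /tract_ext (asboolF nDz) => h.
rewrite ger0_norm ?subr_ge0//; move: h.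
case: asboolP => [/Dw|_ _]; lra.
Qed.

Lemma tract_ext_supported z : supported tract_ext z.
Proof.
case: tract => r0 Do fh fr fb.
have [Dz|nDz] := pselect (D z).
  apply: supported_below (supported_normc (fh _ Dz)); last by rewrite tract_extE.
  by apply: cnear_mono (Do _ Dz) => w Dw; rewrite tract_extE.
apply: supported_below (supported_cst z (ltW r0)); last by rewrite /tract_ext asboolF.
by exists 1 => // w _; exact: tract_ext_ge.
Qed.

Definition log_ext s := tract_ext (cexp s).

Lemma ccont_comp_holo (T : R[i] -> R) (g : R[i] -> R[i]) z :
  cholo g z -> ccont T (g z) -> ccont (fun w => T (g w)) z.
Proof.
move=> /cnear_self[l hl] Tc e e0; have [d d0 hd] := Tc _ e0.
by apply: cnear_mono (cderiv_cont hl d0) => w /hd.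
Qed.

Lemma supported_comp (m : R[i] -> R) (g : R[i] -> R[i]) z :
  cholo g z -> supported m (g z) -> supported (fun w => m (g w)) z.
Proof.
move=> gz [H [Hh He [d d0 hd]]]; exists (fun w => H (g w)); split => //.
  exact: cholo_comp.
have [l hl] := cnear_self gz.
by apply: cnear_mono (cderiv_cont hl d0) => w /hd.
Qed.

Lemma log_ext_ccont s : ccont log_ext s.
Proof. exact: ccont_comp_holo (cholo_cexp s) (tract_ext_ccont _). Qed.

Lemma log_ext_supported s : supported log_ext s.
Proof. exact: supported_comp (cholo_cexp s) (tract_ext_supported _). Qed.

Lemma cexp_arg (s : R[i]) : exists y, [/\ - pi <= y, y <= pi &
  cexp (Re s +i* y) = cexp s].
Proof.
have [+ E] := principal_argP (cexp_neq0 s); rewrite ler_norml => /andP[h1 h2].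
exists (principal_arg (cexp s)); split => //.
by rewrite [RHS]E normc_cexp expRK.
Qed.

(** A vertical line is not compact, but periodicity of exp reduces it to a segment, treated as a
    degenerate rectangle. *)
Lemma log_ext_max x : exists2 y, - pi <= y <= pi &
  forall s, Re s = x -> log_ext s <= log_ext (x +i* y).
Proof.
have p0 : - pi <= pi :> R by have := pi_ge0 R; lra.
have [|[x' y] [/= h1 h2 h3 h4] H] :=
  @rect_EVT R log_ext x x (- pi) pi (lexx x) p0.
  by move=> *; exact: log_ext_ccont.
have xx : x' = x by apply/eqP; rewrite eq_le h1 h2.
subst x'; exists y; first by rewrite h3.
move=> s sx; have [y' [y1 y2 E]] := cexp_arg s.
rewrite {1}/log_ext -E sx; apply: (H (x +i* y')); split => //=.
Qed.

Definition log_max x : R := sup [set log_ext s | s in [set s | Re s = x]].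

Lemma log_max_ge s : log_ext s <= log_max (Re s).
Proof.
have [y _ H] := log_ext_max (Re s).
apply: ub_le_sup; last by exists s.
by exists (log_ext (Re s +i* y)) => _ [t /= tx <-]; exact: H.
Qed.

Lemma log_max_attained x : exists2 y, - pi <= y <= pi & log_max x = log_ext (x +i* y).
Proof.
have [y hy H] := log_ext_max x; exists y => //.
apply/eqP; rewrite eq_le; apply/andP; split; last exact: (log_max_ge (x +i* y)).
apply: ge_sup; first by exists (log_ext (x +i* y)); exists (x +i* y).
by move=> _ [t /= tx <-]; exact: H.
Qed.

Lemma log_max_gt0 x : 0 < log_max x.
Proof.
case: tract => r0 _ _ _ _.
by apply: lt_le_trans (log_max_ge (x +i* 0)); apply: lt_le_trans (tract_ext_ge _).
Qed.

Definition log_growth x := ln (log_max x).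

Lemma expR_log_growth x : expR (log_growth x) = log_max x.
Proof. by rewrite lnK// posrE log_max_gt0. Qed.

Lemma log_ext_le s : log_ext s <= expR (log_growth (Re s)).
Proof. by rewrite expR_log_growth log_max_ge. Qed.

(** Hadamard's three circles theorem in logarithmic coordinates. Multiplying by |exp (- al s - c)|
    subtracts the affine function from the logarithm; this factor depends on Re s only, so the
    product keeps period 2 pi i and attains its weighted maxima on the unbounded strip. *)
Lemma log_growth_convex : convex_chord log_growth.
Proof.
move=> x1 x2 al c x xx1 xx2 P1 P2.
pose W s := log_ext s * normc (cexp (- al%:C * s - c%:C)).
have WE s : W s = log_ext s * expR (- (al * Re s + c)).
  by rewrite /W normc_cexp; congr (_ * expR _); case: s => a b /=; ring.
have hol s : cholo (fun s => cexp (- al%:C * s - c%:C)) s.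
  apply: (@cholo_comp _ (fun s => - al%:C * s - c%:C) (@cexp R)); last exact: cholo_cexp.
  by apply: choloD (cholo_cst _ _); apply: choloM (cholo_cst _ _) (cholo_id _).
have Wc s : ccont W s by apply: ccontM; [exact: log_ext_ccont|exact: cholo_cont].
have Ws s : supported W s.
  by apply: supportedM; [exact: log_ext_supported|exact: supported_normc].
have Wper s : exists y, [/\ - pi <= y, y <= pi & W (Re s +i* y) = W s].
  have [y [y1 y2 E]] := cexp_arg s; exists y; split => //.
  by rewrite !WE /= /log_ext E.
have [y _ Ey] := log_max_attained x.
suff : W (x +i* y) <= 1.
  rewrite WE -Ey -expR_log_growth -expRD -[X in _ <= X]expR0 ler_expR/=; lra.
have Wbd s : log_growth (Re s) <= al * Re s + c -> W s <= 1.
  move=> h; rewrite WE; apply: (@le_trans _ _ (expR (log_growth (Re s)) * expR (- (al * Re s + c)))).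
    by rewrite ler_wpM2r ?expR_ge0 ?log_ext_le.
  by rewrite -expRD -[leRHS]expR0 ler_expR; lra.
have p0 : - pi <= pi :> R by have := pi_ge0 R; lra.
apply: (@max_principle_gen _ W [set s | x1 <= Re s <= x2]
  [set s | Re s = x1 \/ Re s = x2] (`|x1| + `|x2|)) => //=.
- move=> s /andP[h1 h2]; rewrite ler_norml; apply/andP.
  have := ler_norm x2; have := ler_norm (- x1); have := normr_ge0 x1; have := normr_ge0 x2.
  by rewrite normrN => *; split; lra.
- move=> k.
  have [|q [q1 q2 _ _] qmax] := @rect_EVT R (fun z => W z * expR (k * Re z ^+ 2))
    x1 x2 (- pi) pi (le_trans xx1 xx2) p0.
    by move=> z _; exact: ccont_weight.
  exists q; first by rewrite q1.
  move=> s /andP[s1 s2]; have [t [t1 t2 Et]] := Wper s.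
  by rewrite -Et; apply: (qmax (Re s +i* t)).
- move=> s /andP[s1 s2] nb; split=> //.
  have s1' : x1 < Re s by rewrite lt_neqAle s1 andbT; apply/eqP => E; apply: nb; left.
  have s2' : Re s < x2 by rewrite lt_neqAle s2 andbT; apply/eqP => E; apply: nb; right.
  have i1 : Im s - 1 < Im s by lra.
  have i2 : Im s < Im s + 1 by lra.
  by apply: cnear_mono (in_rect_near s1' s2' i1 i2) => w [h1 h2 _ _]; apply/andP.
- by move=> s _ [sx|sx]; apply: Wbd; rewrite sx.
- by rewrite xx1.
Qed.

(** A point of D on the circle has |f| > rho, so the maximum of the extension is not one of the
    artificial values rho. On a circle missing D the supremum defining [max_modulus] would be over
    the empty set. *)
Lemma log_max_modulus x : (exists z, D z /\ normc z = expR x) ->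
  max_modulus f D (expR x) = log_max x.
Proof.
move=> [z0 [Dz0 z0x]]; case: tract => r0 _ _ fr _.
have polar z : normc z = expR x -> exists2 s, Re s = x & cexp s = z.
  move=> zx; have zn0 : z != 0 by rewrite -normc_gt0 zx expR_gt0.
  have [_ E] := principal_argP zn0; exists (x +i* principal_arg z) => //.
  by rewrite [RHS]E zx expRK.
have bd z : D z -> normc z = expR x -> normc (f z) <= log_max x.
  by move=> Dz /polar[s sx sz]; rewrite -tract_extE// -sx -sz; exact: log_max_ge.
apply/eqP; rewrite eq_le; apply/andP; split.
  apply: ge_sup; first by exists (normc (f z0)); exists z0.
  by move=> _ [z [Dz zx] <-]; exact: bd.
have [y _ Ey] := log_max_attained x.
have [Dy|nDy] := pselect (D (cexp (x +i* y))).
  rewrite Ey /log_ext tract_extE//; apply: ub_le_sup.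
    by exists (log_max x) => _ [z [Dz zx] <-]; exact: bd.
  by exists (cexp (x +i* y)) => //; split=> //; rewrite normc_cexp.
have := bd _ Dz0 z0x; have := fr _ Dz0.
by rewrite Ey /log_ext /tract_ext (asboolF nDy) => h1 /(lt_le_trans h1); rewrite ltxx.
Qed.

End TractFunction.

(** * Rigidity at maximum points, unboundedness of f and of its index *)

Section TractGrowth.
Context {R : realType} (f : R[i] -> R[i]) (D : set R[i]) (rho : R).
Context (tract : tract_bound f D rho).
Implicit Types (x h a d e : R) (z s : R[i]).

Notation Phi := (log_growth f D rho).
Notation T := (right_slope Phi).

Let PhiC : convex_chord Phi := log_growth_convex tract.

Lemma expRN8_lt : 2 * expR (- 8) < 1 / 64 :> R.
Proof.
have e1 : 2 <= expR 1 :> R by have := expR_ge1Dx (1 : R); lra.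
rewrite expRN -[8]mul1r expRM_natr.
have h : 2 ^+ 8 <= expR 1 ^+ 8 :> R by rewrite ler_pXn2r ?nnegrE ?expR_ge0//; lra.
have p : 0 < expR 1 ^+ 8 :> R by rewrite exprn_gt0// expR_gt0.
rewrite ltr_pdivrMr//.
by move: h; rewrite -natrX (_ : (2 ^ 8)%N = 256%N)//; lra.
Qed.

(* In logarithmic coordinates s = log z the power (z / z_r) ^ a becomes
   exp (a (s - s_r)). *)
Lemma log_rigidity x s0 a d e : 0 < d -> 0 < e -> e <= 1 / 64 ->
  Re s0 = x -> D (cexp s0) -> normc (f (cexp s0)) = expR (Phi x) ->
  (forall h, `|h| <= 320 * d -> Phi (x + h) <= Phi x + a * h + ln (1 + e)) ->
  (forall h, `|h| <= 320 * d -> ln rho + 9 <= Phi x + a * h) ->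
  forall s, in_square s0 d s -> D (cexp s) /\
    normc (f (cexp s) / (f (cexp s0) * cexp (a%:C * (s - s0))) - 1) <= 2 * e.
Proof.
case: (tract) => r0 Do fh fr fb.
move=> d0 e0 e64 s0x Ds0 fs0 up low s sin.
pose U := [set t | D (cexp t)].
pose F t := f (cexp t) * (f (cexp s0))^-1 * cexp (- (a%:C * (t - s0))).
have f0 : f (cexp s0) != 0 by rewrite -normc_gt0 fs0 expR_gt0.
have nF t : normc (F t) = normc (f (cexp t)) * expR (- (Phi x + a * (Re t - x))).
  rewrite /F normcM normcM normcV fs0 -expRN normc_cexp -mulrA -expRD; congr (_ * expR _).
  by rewrite -s0x; case: (t) => t1 t2; case: (s0) => u1 u2 /=; ring.
have Uo t : U t -> cnear t U.
  move=> /Do[dl dl0 hd].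
  by apply: cnear_mono (cderiv_cont (cderiv_cexp t) dl0) => w /hd.
have FU t : U t -> cholo F t.
  move=> Ut; apply: choloM.
    by apply: choloM (cholo_cst _ _); exact: cholo_comp (cholo_cexp t) (fh _ Ut).
  apply: (@cholo_comp _ (fun t => - (a%:C * (t - s0))) (@cexp R)); last exact: cholo_cexp.
  have h : cholo (fun u => (- a%:C) * (u - s0)) t.
    by apply: choloM (cholo_cst _ _) _; apply: choloD (cholo_id _) (cholo_cst _ _).
  by apply: cnear_mono h => w [l hl]; exists l; apply: cderiv_ext hl; exists 1 => // v _; ring.
have Fs0 : F s0 = 1.
  by rewrite /F subrr mulr0 oppr0 cexp0 mulr1 divff.
have hin t : in_square s0 (320 * d) t -> `|Re t - x| <= 320 * d.
  by move=> [h _]; move: h; rewrite raddfB/= s0x.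
have := @rigidity _ U F s0 d e d0 e0 e64 Uo FU Ds0 Fs0.
have h1 t : in_square s0 (320 * d) t -> U t -> normc (F t) <= 1 + e.
  move=> tin Ut; rewrite nF.
  have := log_ext_le tract t; rewrite /log_ext tract_extE// => le1.
  apply: le_trans (ler_wpM2r (expR_ge0 _) le1) _.
  rewrite -expRD -[leRHS]lnK ?posrE; last by lra.
  rewrite ler_expR; have := up _ (hin _ tin).
  by rewrite addrC subrK; lra.
have h2 t : in_square s0 (320 * d) t -> ~ U t ->
    cnear t (fun w => U w -> normc (F w) < 1 / 64).
  move=> tin Ut; have [dl dl0 hd] := fb _ Ut _ r0.
  (* Within this radius a (s - s0) varies by at most 1, which turns the 9 of the lower bound into 8.
     Together with |f| < 2 rho this gives |F| < 2 exp (-8) < 1/64. *)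
  have a0 : 0 < (`|a| + 1)^-1 by rewrite invr_gt0; have := normr_ge0 a; lra.
  have near2 : cnear t (fun w => normc (w - t) < (`|a| + 1)^-1) by exists (`|a| + 1)^-1.
  apply: cnear_mono (cnearI (cderiv_cont (cderiv_cexp t) dl0) near2) => w [/hd fw wt] /fw {}fw.
  rewrite nF; have L := low _ (hin _ tin).
  have aw : `|a * (Re w - Re t)| <= 1.
    rewrite normrM; have rw : `|Re w - Re t| <= (`|a| + 1)^-1.
      by rewrite -raddfB; apply: le_trans (Re_le_normc _) (ltW wt).
    have : `|a| * `|Re w - Re t| <= (`|a| + 1) * (`|a| + 1)^-1 by apply: ler_pM => //; lra.
    by rewrite divff// -invr_eq0 gt_eqF.
  have E : expR (- (Phi x + a * (Re w - x))) <= expR (- 8) / rho.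
    rewrite -[in leRHS](lnK r0) -expRN -expRD ler_expR.
    have -> : a * (Re w - x) = a * (Re t - x) + a * (Re w - Re t) by ring.
    by move: aw; rewrite ler_norml => /andP[aw _]; lra.
  apply: (@le_lt_trans _ _ ((2 * rho) * (expR (- 8) / rho))).
    by apply: ler_pM; rewrite ?normc_ge0 ?expR_ge0//; lra.
  have -> : 2 * rho * (expR (- 8) / rho) = 2 * expR (- 8) by field; rewrite gt_eqF.
  exact: expRN8_lt.
move=> /(_ h1 h2 s sin) [Us Fs]; split => //.
have -> : f (cexp s) / (f (cexp s0) * cexp (a%:C * (s - s0))) = F s; last by [].
by rewrite /F cexpN invfM mulrA.
Qed.

(** If |f| had a finite supremum on D, then f divided by a nearly maximal value would satisfy the
    hypotheses of [complement_far] after taking a power. That lemma holds at every scale, so the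
    square can be chosen to contain a point outside D. *)
Lemma tract_unbounded : D !=set0 -> (exists w, ~ D w) ->
  forall B : R, exists2 z, D z & B < normc (f z).
Proof.
case: (tract) => r0 Do fh fr fb [z1 Dz1] [w0 Dw0] B; apply: contrapT => nB.
pose A := [set normc (f z) | z in D].
have supA : has_sup A.
  split; first by exists (normc (f z1)); exists z1.
  exists B => _ [z Dz <-]; rewrite leNgt; apply/negP => Bz; apply: nB.
  by exists z.
pose S := sup A.
have leS z : D z -> normc (f z) <= S by move=> Dz; apply: ub_le_sup; [case: supA|exists z].
have rS : rho < S := lt_le_trans (fr _ Dz1) (leS _ Dz1).
(* Here rho < tau < sg < S: |f| < tau near the complement and |f c| > sg, so the power k + 1 of f /
   f c is below 1/64 there once t^(k+1) is. The number [eta] is the excess of S / |f c| over 1 that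
   this power tolerates. *)
pose sg := (rho + S) / 2; pose tau := (rho + sg) / 2; pose t := tau / sg.
have sg0 : 0 < sg by rewrite /sg; lra.
have t0 : 0 <= t by rewrite divr_ge0 ?(ltW sg0)// /tau /sg; lra.
have t1 : t < 1 by rewrite ltr_pdivrMr// mul1r /tau /sg; lra.
have [k tk] : exists k, t ^+ k.+1 < 1 / 64.
  have : t ^+ n @[n --> \oo] --> (0 : R) by apply: cvg_expr; rewrite ger0_norm.
  move=> /cvgr_dist_lt /(_ (1 / 64)) [|N _ hN]; first lra.
  exists N; have := hN N.+1 (leqnSn N); rewrite /= sub0r normrN ger0_norm//.
  exact: exprn_ge0.
pose eta := ln (1 + 1 / 64) / k.+1%:R : R.
have l0 : 0 < ln (1 + 1 / 64) :> R by rewrite ln_gt0//; lra.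
have eta0 : 0 < eta by rewrite divr_gt0.
have etak : (1 + eta) ^+ k.+1 <= 1 + 1 / 64.
  apply: (@le_trans _ _ (expR eta ^+ k.+1)).
    by rewrite ler_pXn2r ?nnegrE ?expR_ge0 ?expR_ge1Dx//; lra.
  by rewrite -expRM_natr /eta divfK ?pnatr_eq0// lnK// posrE; lra.
have lowS : Num.max sg (S / (1 + eta)) < S.
  rewrite gt_max; apply/andP; split; first by rewrite /sg; lra.
  by rewrite ltr_pdivrMr ?ltr_pMr; lra.
have eS : 0 < S - Num.max sg (S / (1 + eta)) by rewrite subr_gt0.
have [_ [c Dc <-]] := sup_adherent eS supA.
rewrite -/S opprB addrC subrK gt_max => /andP[c1 c2].
have fc0 : 0 < normc (f c) := lt_trans sg0 c1.
have fcn : f c != 0 by rewrite -normc_gt0.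
pose F z := (f z / f c) ^+ k.+1.
have FD z : D z -> cholo F z by move=> Dz; apply: choloX; apply: choloM (fh _ Dz) (cholo_cst _ _).
have Fc : F c = 1 by rewrite /F divff// expr1n.
pose d := normc (w0 - c) + 1.
have d0 : 0 < d by rewrite /d; have := normc_ge0 (w0 - c); lra.
apply: Dw0; apply: (@complement_far _ D F c d d0 Do FD Dc Fc).
- move=> z _ Dz; rewrite /F normcX normcM normcV; apply: le_trans etak.
  rewrite ler_pXn2r ?nnegrE ?divr_ge0 ?normc_ge0//; last by lra.
  rewrite ler_pdivrMr//; apply: le_trans (leS _ Dz) _.
  by move: c2; rewrite ltr_pdivrMr; [lra|lra].
- move=> z _ nDz; have e0 : 0 < tau - rho by rewrite /tau /sg; lra.
  apply: cnear_mono (fb _ nDz _ e0) => w fw /fw {}fw.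
  rewrite /F normcX normcM normcV; apply: le_lt_trans tk.
  rewrite ler_pXn2r ?nnegrE ?divr_ge0 ?normc_ge0//; try lra.
  rewrite /t; apply: ler_pM; rewrite ?normc_ge0 ?invr_ge0 ?normc_ge0//; first by lra.
  by rewrite lef_pV2 ?posrE//; exact: ltW.
- by split; [apply: le_trans (Re_le_normc _) _|apply: le_trans (Im_le_normc _) _];
    rewrite /d; lra.
Qed.

Context (Dn0 : D !=set0).
Context (complement_unbounded : forall B : R, exists2 w, ~ D w & B < normc w).

Lemma log_growth_unbounded (B x0 : R) : exists2 x, x0 <= x & B < Phi x.
Proof.
case: (tract) => r0 _ _ _ _.
have [w Dw _] := complement_unbounded 0.
have re0 : - expR x0 <= expR x0 by have := expR_gt0 x0; lra.
have [|q _ qmax] := @rect_EVT R (tract_ext f D rho) (- expR x0) (expR x0) (- expR x0)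
  (expR x0) re0 re0; first by move=> z _; exact: (tract_ext_ccont tract).
have [z Dz] := tract_unbounded Dn0 (ex_intro _ w Dw) (Num.max (tract_ext f D rho q) (expR B)).
rewrite gt_max => /andP[z1 z2].
have zbig : expR x0 < normc z.
  rewrite ltNge; apply/negP => zs.
  have : tract_ext f D rho z <= tract_ext f D rho q.
    have := le_trans (Re_le_normc z) zs; have := le_trans (Im_le_normc z) zs.
    by rewrite !ler_norml => /andP[? ?] /andP[? ?]; apply: qmax; split.
  by rewrite tract_extE// leNgt z1.
have zn : z != 0 by rewrite -normc_gt0; apply: lt_trans zbig; exact: expR_gt0.
have [_ E] := principal_argP zn.
have ez := lt_trans (expR_gt0 x0) zbig.
exists (ln (normc z)).
  by rewrite -(expRK x0) ler_ln ?posrE ?expR_gt0// ltW.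
have := log_ext_le tract (ln (normc z) +i* principal_arg z).
rewrite /log_ext -E tract_extE//= => h.
by have := lt_le_trans z2 h; rewrite ltr_expR.
Qed.

Lemma log_growth_cvg (B : R) : exists X, forall x, X <= x -> B <= Phi x.
Proof.
have [x1 x10 P1] := log_growth_unbounded (Phi 0) 1.
have T1 : 0 < T x1.
  have := right_slope_support PhiC x1 0 => h.
  have : 0 < T x1 * x1 by lra.
  by rewrite pmulr_lgt0//; lra.
exists (x1 + `|B - Phi x1| / T x1) => x xx.
have := right_slope_support PhiC x1 x.
have : `|B - Phi x1| <= T x1 * (x - x1) by rewrite mulrC -ler_pdivrMr//; lra.
have := ler_norm (B - Phi x1); lra.
Qed.

Definition tract_meets (x : R) := exists z, D z /\ normc z = expR x.

Lemma log_max_point x : tract_meets x ->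
  exists y, [/\ - pi <= y, y <= pi, D (cexp (x +i* y)) &
    normc (f (cexp (x +i* y))) = expR (Phi x)].
Proof.
case: (tract) => r0 _ _ fr _ mx; have [y /andP[y1 y2] Ey] := log_max_attained tract x.
have [z [Dz zx]] := mx.
have Dy : D (cexp (x +i* y)).
  apply: contrapT => nDy; have zn : z != 0 by rewrite -normc_gt0 zx expR_gt0.
  have [_ E] := principal_argP zn.
  have := log_max_ge tract (ln (normc z) +i* principal_arg z).
  rewrite /log_ext -E tract_extE//= zx expRK Ey /log_ext /tract_ext (asboolF nDy).
  by have := fr _ Dz; rewrite ltNge => /negP.
exists y; split => //; rewrite (expR_log_growth tract) Ey /log_ext tract_extE//.
Qed.

Lemma ln1D_ge e : 0 <= e -> e <= 1 -> e / 2 <= ln (1 + e).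
Proof.
move=> e0 e1; rewrite -ler_expR lnK ?posrE; last by lra.
have h := expR_ge1Dx (- (e / 2)).
rewrite -[leLHS]invrK -expRN -[leRHS]invrK lef_pV2 ?posrE ?invr_gt0 ?expR_gt0//; last by lra.
apply: le_trans h; rewrite invf_ple ?posrE; [|lra|lra].
have p : 0 < 1 + - (e / 2) by lra.
by rewrite -[_^-1]mul1r ler_pdivrMr//; nra.
Qed.

Lemma index_cvg x0 : (forall x, x0 <= x -> tract_meets x) ->
  forall B : R, exists X, forall x, X <= x -> B <= T x.
Proof.
move=> meets B; apply: contrapT => nT.
have TB x : T x <= B.
  rewrite leNgt; apply/negP => Bx; apply: nT; exists x => y xy.
  by apply: ltW; apply: lt_le_trans Bx _; exact: right_slope_nondecr.
have supT : has_sup (range T).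
  by split; [exists (T 0); exists 0|exists B => _ [x _ <-]].
pose N0 := sup (range T).
have TN x : T x <= N0 by apply: ub_le_sup; [case: supT|exists x].
(* As 2 pi < 8, the square of half side 8 around a maximum point covers a full period of its
   vertical line, hence the whole circle. Once T is within e / 2 / H of its supremum, Phi is affine
   up to e / 2 on windows of half length H. *)
pose H := 320 * 8 : R; pose e := 1 / 64 : R.
have H0 : 0 < H by rewrite /H; lra.
have eH : 0 < e / 2 / H by rewrite !divr_gt0// /e; lra.
have [_ [x1 _ <-]] := sup_adherent eH supT; rewrite -/N0 => x1T.
have [X2 X2P] := log_growth_cvg (ln rho + 10).
pose X := Num.max (Num.max x0 x1) X2 + H.
have circ x z : X <= x -> normc z = expR x -> D z.
  move=> Xx zx.
  have [xx0 xx1 xx2] : [/\ x0 <= x - H, x1 <= x - H & X2 <= x - H].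
    have : Num.max (Num.max x0 x1) X2 <= x - H by move: Xx; rewrite /X; lra.
    by rewrite !ge_max => /andP[/andP[? ?] ?].
  have mx : tract_meets x by apply: meets; lra.
  have [y [y1 y2 Dy fy]] := log_max_point mx.
  have zn : z != 0 by rewrite -normc_gt0 zx expR_gt0.
  have [] := principal_argP zn; set th := principal_arg z.
  rewrite ler_norml zx expRK => /andP[t1 t2] E.
  have up h : `|h| <= H -> Phi (x + h) <= Phi x + T x * h + e / 2.
    move=> hH; have := right_slope_support PhiC (x + h) x.
    have -> : x - (x + h) = - h by ring.
    have hl : - H <= h by move: hH; rewrite ler_norml => /andP[].
    have a1 : N0 - e / 2 / H < T (x + h).
      by apply: lt_le_trans x1T _; apply: right_slope_nondecr => //; lra.
    have a2 : N0 - e / 2 / H < T x.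
      by apply: lt_le_trans x1T _; apply: right_slope_nondecr => //; lra.
    have a3 := TN (x + h); have a4 := TN x.
    have b : `|(T (x + h) - T x) * h| <= e / 2 / H * H.
      rewrite normrM; apply: ler_pM => //.
      by rewrite ler_norml; apply/andP; split; lra.
    have : e / 2 / H * H = e / 2 by rewrite divfK ?gt_eqF.
    by have := ler_norm ((T (x + h) - T x) * h); lra.
  have := @log_rigidity x (x +i* y) (T x) 8 e.
  have l1 : e / 2 <= ln (1 + e) by apply: ln1D_ge; rewrite /e; lra.
  move=> /(_ _ _ _ _ Dy fy); rewrite /e => /(_ _ _ _ _ _ _ (x +i* th)) => G.
  rewrite E; apply: (G _ _ _ _ _ _ _).1 => //; rewrite -?/e.
  - by move=> h hH; apply: le_trans (up h hH) _; rewrite /e in l1 *; lra.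
  - move=> h hH; have := up h hH.
    have : ln rho + 10 <= Phi (x + h).
      apply: X2P; move: hH; rewrite ler_norml -/H => /andP[]; lra.
    by rewrite /e; lra.
  - split; rewrite /= ?subrr ?normr0//.
    have := pihalf_lt2 R; rewrite ler_norml => p; apply/andP; split; lra.
have [w Dw wX] := complement_unbounded (expR X).
apply: Dw; have w0 := lt_trans (expR_gt0 X) wX.
apply: (circ (ln (normc w))); last by rewrite lnK.
by rewrite -(expRK X) ler_ln ?posrE ?expR_gt0// ltW.
Qed.

End TractGrowth.

(** * Monotonicity of psi and of psi / t^2 *)

Section RegularGrowth.
Context {R : realType} (t0 : R) (psi psi' : R -> R).
Context (t0_gt0 : 0 < t0) (psi_gt0 : forall t, t0 <= t -> 0 < psi t).
Context (psi_deriv : forall t, t0 <= t ->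
  has_derivative_within [set s : R | t0 <= s] psi t (psi' t)).
Context (psi'_bounds : forall t, t0 <= t ->
  0 <= t * psi' t / psi t /\ t * psi' t / psi t <= 2).

Lemma is_derive_psi t : t0 < t -> is_derive t 1 psi (psi' t).
Proof.
move=> tt.
have h : h^-1 *: (psi (h *: 1 + t) - psi t) @[h --> 0^'] --> psi' t.
  apply/cvgrPdist_lt => e e0.
  have /cvgrPdist_lt /(_ _ e0) [d /= d0 hd] := psi_deriv (ltW tt).
  near=> h.
  have h0 : h != 0 by near: h; exact: nbhs_dnbhs_neq.
  have hs : `|h| < Num.min d (t - t0).
    near: h; apply: dnbhs0_lt; rewrite lt_min d0; lra.
  move: hs; rewrite lt_min => /andP[hd1 hd2].
  have := hd (h + t) => /=.
  rewrite (_ : t - (h + t) = - h); last by ring.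
  rewrite normrN => /(_ hd1).
  rewrite (_ : h + t - t = h); last by ring.
  rewrite -[h *: 1]/(h * 1) mulr1 -[_ *: _]/(h^-1 * _) [h^-1 * _]mulrC; apply.
    by rewrite -subr_eq0 (_ : h + t - t = h)//; ring.
  by have := ler_norm (- h); rewrite normrN; lra.
by apply: DeriveDef; [apply: cvgP h|apply: cvg_lim h].
Unshelve. all: by end_near. Qed.

Lemma psi_continuous t : t0 < t -> {for t, continuous psi}.
Proof.
move=> tt; apply: differentiable_continuous; apply/derivable1_diffP.
by case: (is_derive_psi tt).
Qed.

Lemma psi_nondecr s t : t0 < s -> s <= t -> psi s <= psi t.
Proof.
move=> ts; rewrite le_eqVlt => /orP[/eqP->//|st].
have [||c] := @MVT R psi psi' s t st.
- by move=> x; rewrite in_itv/= => /andP[sx _]; apply: is_derive_psi; lra.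
- apply: continuous_in_subspaceT => x; rewrite inE/= in_itv/= => /andP[sx _].
  by apply: psi_continuous; lra.
rewrite in_itv/= => /andP[sc ct] E.
have c0 : t0 <= c by lra.
have [p0 _] := psi'_bounds c0; have pc := psi_gt0 c0.
have : 0 <= psi' c.
  have cp : 0 < c by have := t0_gt0; lra.
  by move: p0; rewrite pmulr_lge0 ?invr_gt0// pmulr_rge0.
move=> p'; have : 0 <= psi' c * (t - s) by rewrite mulr_ge0//; lra.
by lra.
Qed.

(** The derivative of psi / t^2 is (t psi' - 2 psi) / t^3, which is not positive. *)
Lemma psi_div_sqr_nonincr s t : t0 < s -> s <= t -> psi t <= (t / s) ^+ 2 * psi s.
Proof.
move=> ts; rewrite le_eqVlt => /orP[/eqP<-|st].
  by rewrite divff ?expr1n ?mul1r// gt_eqF//; have := t0_gt0; lra.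
pose g u := psi u * u ^- 2.
pose g' u := psi u * (- 2 * u ^- 3) + u ^- 2 * psi' u.
have gd u : t0 < u -> is_derive u 1 g (g' u).
  move=> tu; have up : u != 0 by rewrite gt_eqF//; have := t0_gt0; lra.
  have hp := is_derive_psi tu.
  have h2 : is_derive u 1 (fun x : R => x ^- 2) (- 2 * u ^- 3).
    have hx : is_derive u 1 (fun x : R => x ^+ 2) (2 * u).
      apply: is_derive_eq; rewrite -[_ *: _]/(_ * _); ring.
    have u2 : u ^+ 2 != 0 by rewrite expf_neq0.
    have := @is_deriveV R (fun x : R => x ^+ 2) u _ 1 u2 hx.
    move=> hV; apply: is_derive_eq; rewrite -[_ *: _]/(_ * _); field.
    exact: up.
  exact: is_deriveM.
have [||c] := @MVT R g g' s t st.
- by move=> x; rewrite in_itv/= => /andP[sx _]; apply: gd; lra.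
- apply: continuous_in_subspaceT => x; rewrite inE/= in_itv/= => /andP[sx _].
  apply: differentiable_continuous; apply/derivable1_diffP.
  by case: (gd x) => //; lra.
rewrite in_itv/= => /andP[sc ct] E.
have c0 : t0 <= c by lra.
have [_ p2] := psi'_bounds c0; have pc := psi_gt0 c0.
have cp : 0 < c by have := t0_gt0; lra.
have g'0 : g' c <= 0.
  move: p2; rewrite ler_pdivrMr// => p2.
  have -> : g' c = (c * psi' c - 2 * psi c) * c ^- 3 by rewrite /g'; field; rewrite gt_eqF.
  by rewrite mulr_le0_ge0 ?invr_ge0 ?exprn_ge0 ?(ltW cp)//; lra.
have : g' c * (t - s) <= 0 by rewrite mulr_le0_ge0//; lra.
rewrite -E /g => h.
have t2 : 0 < t ^+ 2 by rewrite exprn_gt0//; have := t0_gt0; lra.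
have {}h : psi t * t ^- 2 <= psi s * s ^- 2 by lra.
rewrite -(ler_pM2r t2) divfK ?gt_eqF// in h.
rewrite expr_div_n; lra.
Qed.

End RegularGrowth.

(** * Comparison of right Riemann sums with the integral of 1 / psi *)

Section IntegralTest.
Context {R : realType} (t0 : R) (psi : R -> R).
Context (psi_gt0 : forall t, t0 <= t -> 0 < psi t).
Context (psi_cont : forall t, t0 < t -> {for t, continuous psi}).
Context (psi_incr : forall s t, t0 < s -> s <= t -> psi s <= psi t).
Notation mu := (@lebesgue_measure R).

Lemma measurable_inv_psi :
  measurable_fun `[t0, +oo[%classic (EFin \o (fun t : R => (psi t)^-1)).
Proof.
apply/measurable_EFinP.
(* Two-sided continuity is only available to the right of t0, where psi is not constrained on both
   sides; a single point is measurable anyway. *)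
have -> : `[t0, +oo[%classic = [set t0] `|` `]t0, +oo[%classic.
  by rewrite setU1itv// bnd_simp.
apply/measurable_funU => //; split; first exact: measurable_fun_set1.
apply: open_continuous_measurable_fun; first exact: interval_open.
move=> t; rewrite inE/= in_itv/= andbT => tt.
apply: continuous_comp; first exact: psi_cont.
by apply: inv_continuous; rewrite gt_eqF// psi_gt0// ltW.
Qed.

Lemma sum_le_integral (tau : nat -> R) n : (forall k, tau k <= tau k.+1) ->
  t0 < tau 0%N ->
  ((\sum_(k < n) (tau k.+1 - tau k) / psi (tau k.+1))%:E <=
    \int[mu]_(t in `[t0, +oo[) ((psi t)^-1)%:E)%E.
Proof.
move=> tm tau0.
have tau_ge k : tau 0%N <= tau k by elim: k => // k /le_trans; apply.
have tau_gt k : t0 < tau k := lt_le_trans tau0 (tau_ge k).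
have subA k : `]tau 0%N, tau k]%classic `<=` `[t0, +oo[%classic.
  by move=> t /=; rewrite !in_itv/= andbT => /andP[+ _]; have := tau_gt 0%N; lra.
have subB k : `]tau k, tau k.+1]%classic `<=` `[t0, +oo[%classic.
  by move=> t /=; rewrite !in_itv/= andbT => /andP[+ _]; have := tau_gt k; lra.
have p0 t : `[t0, +oo[%classic t -> (0 <= ((psi t)^-1)%:E)%E.
  by rewrite /= in_itv/= andbT => h; rewrite lee_fin invr_ge0 ltW// psi_gt0.
have mS (A : set R) : measurable A -> A `<=` `[t0, +oo[%classic ->
    measurable_fun A (EFin \o (fun t : R => (psi t)^-1)).
  by move=> mA sA; apply: measurable_funS measurable_inv_psi.
apply: (@le_trans _ _ (\int[mu]_(t in `]tau 0%N, tau n]) ((psi t)^-1)%:E)%E); last first.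
  by apply: ge0_subset_integral => //; exact: measurable_inv_psi.
elim: n => [|n ih]; first by rewrite big_ord0 set_itv_ge ?integral_set0 ?bnd_simp ?ltxx.
have -> : `]tau 0%N, tau n.+1]%classic = `]tau 0%N, tau n]%classic `|` `]tau n, tau n.+1]%classic.
  by rewrite -itv_bndbnd_setU// bnd_simp.
rewrite ge0_integral_setU//=; last first.
- rewrite disj_set2E; apply/eqP; rewrite predeqE => t; split => //=.
  by rewrite !in_itv/= => -[/andP[_ h1] /andP[h2 _]]; lra.
- by move=> t [/subA|/subB]; exact: p0.
- apply: mS; first exact: measurableU.
  by move=> t [/subA|/subB].
rewrite big_ord_recr/= EFinD leeD//.
have -> : ((tau n.+1 - tau n) / psi (tau n.+1))%:E =
    (\int[mu]_(t in `]tau n, tau n.+1]) ((psi (tau n.+1))^-1)%:E)%E.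
  rewrite integral_cst//= lebesgue_measure_itv/= lte_fin.
  case: ltgtP (tm n) => // [_ _|-> _]; last by rewrite subrr mul0r mule0.
  by rewrite -EFinB -EFinM mulrC.
apply: ge0_le_integral => //=.
- by move=> t _; rewrite lee_fin invr_ge0 ltW// psi_gt0// ltW.
- exact: mS.
- move=> t; rewrite in_itv/= => /andP[h1 h2]; rewrite lee_fin lef_pV2 ?posrE.
  + by apply: psi_incr => //; have := tau_gt n; lra.
  + by apply: psi_gt0; rewrite ltW.
  + by apply: psi_gt0; have := tau_gt n; lra.
Qed.

End IntegralTest.

(** * A growth lemma of Borel type *)

Section BorelLemma.
Context {R : realType} (t0 : R) (psi : R -> R).
Context (t0_gt0 : 0 < t0) (psi_gt0 : forall t, t0 <= t -> 0 < psi t).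
Context (psi_cont : forall t, t0 < t -> {for t, continuous psi}).
Context (psi_incr : forall s t, t0 < s -> s <= t -> psi s <= psi t).
Context (psi_sqr : forall s t, t0 < s -> s <= t -> psi t <= (t / s) ^+ 2 * psi s).
Context (psi_int :
  (\int[lebesgue_measure]_(t in `[t0, +oo[) ((psi t)^-1)%:E < +oo)%E).

(** The step is chosen so that a step divided by psi at its left end is e / sqrt(psi). The start t0
    + 1 keeps all levels in the open half-line where psi is continuous. *)
Fixpoint level (e : R) k : R :=
  if k is j.+1 then level e j + e * Num.sqrt (psi (level e j)) else t0 + 1.

Lemma level_gt e k : 0 < e -> t0 + 1 <= level e k.
Proof.
move=> e0; elim: k => //= k ih; apply: le_trans ih _.
by rewrite lerDl mulr_ge0 ?sqrtr_ge0 ?ltW.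
Qed.

Lemma level_gt0 e k : 0 < e -> t0 < level e k.
Proof. by move=> e0; have := level_gt k e0; lra. Qed.

Lemma sqrt_psi_gt0 t : t0 <= t -> 0 < Num.sqrt (psi t).
Proof. by move=> tt; rewrite sqrtr_gt0 psi_gt0. Qed.

Lemma levelS e k : 0 < e -> level e k <= level e k.+1.
Proof. by move=> e0; rewrite /= lerDl mulr_ge0 ?sqrtr_ge0 ?ltW. Qed.

Lemma level_unbounded e (B : R) : 0 < e -> exists k, B < level e k.
Proof.
move=> e0; pose q := e * Num.sqrt (psi (t0 + 1)).
have q0 : 0 < q by apply: mulr_gt0 => //; apply: sqrt_psi_gt0; lra.
have lb k : k%:R * q <= level e k.
  elim: k => [|k ih]; first by rewrite mul0r /=; have := t0_gt0; lra.
  rewrite /= -natr1 mulrDl mul1r lerD// /q ler_pM2l// ler_wsqrtr//.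
  by apply: psi_incr; [lra|exact: level_gt].
exists (Num.bound (`|B| / q)).
have : `|B| / q < (Num.bound (`|B| / q))%:R by apply: archi_boundP; apply: divr_ge0 => //; exact: ltW.
rewrite ltr_pdivrMr// => h; have := lb (Num.bound (`|B| / q)); have := ler_norm B; lra.
Qed.

(** The terms form 1 / e times a left Riemann sum for 1 / psi, while the integral of this decreasing
    function dominates right sums. Passing from left to right costs q^2, where q bounds the ratio of
    consecutive levels because sqrt(psi) grows at most linearly. *)
Lemma sum_inv_sqrt_bounded e : 0 < e ->
  exists C : R, forall n, \sum_(k < n) (Num.sqrt (psi (level e k)))^-1 <= C.
Proof.
move=> e0; pose s1 := Num.sqrt (psi (t0 + 1)) / (t0 + 1).
have t1 : 0 < t0 + 1 by have := t0_gt0; lra.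
have s10 : 0 < s1 by rewrite divr_gt0//; apply: sqrt_psi_gt0; lra.
pose q := 1 + e * s1; have q0 : 0 < q by rewrite /q; have := mulr_gt0 e0 s10; lra.
have lin t : t0 + 1 <= t -> Num.sqrt (psi t) <= s1 * t.
  move=> tt; have t00 : t0 < t0 + 1 by lra.
  apply: le_trans (ler_wsqrtr (psi_sqr t00 tt)) _.
  rewrite sqrtrM ?sqr_ge0// sqrtr_sqr ger0_norm ?divr_ge0 ?(ltW t1)//; last by lra.
  by rewrite /s1 le_eqVlt; apply/orP; left; apply/eqP; field; rewrite gt_eqF.
have ratio k : level e k.+1 / level e k <= q.
  have lk := lt_le_trans t1 (level_gt k e0).
  rewrite ler_pdivrMr//= /q mulrDl mul1r lerD2l -mulrA ler_pM2l//.
  exact: lin (level_gt k e0).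
have term k : (Num.sqrt (psi (level e k)))^-1 <=
    q ^+ 2 / e * ((level e k.+1 - level e k) / psi (level e k.+1)).
  have lk := lt_le_trans t1 (level_gt k e0).
  have pk : 0 < psi (level e k) by apply: psi_gt0; rewrite ltW// level_gt0.
  have pk1 : 0 < psi (level e k.+1) by apply: psi_gt0; rewrite ltW// level_gt0.
  have sk : 0 < Num.sqrt (psi (level e k)) by rewrite sqrtr_gt0.
  have -> : level e k.+1 - level e k = e * Num.sqrt (psi (level e k)) by rewrite /= addrC addKr.
  have h : psi (level e k.+1) <= q ^+ 2 * psi (level e k).
    apply: le_trans (psi_sqr (level_gt0 k e0) (levelS k e0)) _.
    rewrite ler_pM2r// ler_pXn2r ?nnegrE ?(ltW q0)//.
    by rewrite divr_ge0 ?(ltW lk)// ltW// (lt_le_trans t1 (level_gt k.+1 e0)).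
  rewrite -[psi (level e k)]sqr_sqrtr ?(ltW pk)// in h.
  rewrite -subr_ge0; set s := Num.sqrt _ in h sk *; set P := psi _ in h pk1 *.
  have -> : q ^+ 2 / e * (e * s / P) - s^-1 = (q ^+ 2 * s ^+ 2 - P) / (s * P).
    by field; rewrite !gt_eqF.
  by rewrite divr_ge0 ?subr_ge0// mulr_ge0// ltW.
exists (q ^+ 2 / e * fine (\int[lebesgue_measure]_(t in `[t0, +oo[) ((psi t)^-1)%:E)%E) => n.
apply: le_trans (ler_sum _ (fun (k : 'I_n) _ => term k)) _.
rewrite -mulr_sumr; apply: ler_wpM2l.
  by apply: divr_ge0; [exact: sqr_ge0|exact: ltW].
have H := sum_le_integral psi_gt0 psi_cont psi_incr n (fun k => levelS k e0) (level_gt0 0 e0).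
rewrite -lee_fin fineK// ge0_fin_numE//.
apply: integral_ge0 => t /=; rewrite in_itv/= andbT => tt.
by rewrite lee_fin invr_ge0 ltW// psi_gt0.
Qed.

(** Otherwise monotonicity keeps sqrt(psi) below 2, and bounded sums would have all their terms at
    least 1/2. The bound 2 keeps z / z_r within 1/2 of 1, away from the branch cut. *)
Lemma sqrt_psi_large : exists X, forall t, X <= t -> 2 <= Num.sqrt (psi t).
Proof.
apply: contrapT => nX.
have small t : t0 < t -> Num.sqrt (psi t) < 2.
  move=> tt; rewrite ltNge; apply/negP => st; apply: nX; exists t => s ts.
  by apply: le_trans st _; apply: ler_wsqrtr; exact: psi_incr.
have [C hC] := sum_inv_sqrt_bounded ltr01.
pose n := Num.bound (2 * `|C|).
have : 2 * `|C| < n%:R by apply: archi_boundP; rewrite mulr_ge0.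
have : \sum_(k < n) (1 / 2 : R) <= \sum_(k < n) (Num.sqrt (psi (level 1 k)))^-1.
  apply: ler_sum => k _; have lk := level_gt0 k ltr01.
  have sk : 0 < Num.sqrt (psi (level 1 k)) by apply: sqrt_psi_gt0; exact: ltW.
  by rewrite div1r lef_pV2 ?posrE// ltW// small.
rewrite sumr_const card_ord -[_ *+ n]mulr_natr.
by have := hC n; have := ler_norm C; lra.
Qed.

Lemma summable_tail (u : nat -> R) (C dl : R) : (forall k, 0 <= u k) ->
  (forall n, \sum_(k < n) u k <= C) -> 0 < dl ->
  exists N, forall n, \sum_(k < n) u (N + k)%N <= dl.
Proof.
move=> u0 uC d0; pose A := range (fun n => \sum_(k < n) u k).
have supA : has_sup A.
  by split; [exists (\sum_(k < 0) u k); exists 0%N|exists C => _ [n _ <-]].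
have [_ [N _ <-] hN] := sup_adherent d0 supA; exists N => n.
have : \sum_(k < N + n) u k <= sup A by apply: ub_le_sup; [case: supA|exists (N + n)%N].
by rewrite big_split_ord/=; lra.
Qed.

Context (Phi T : R -> R).
Context (T_incr : forall x y, x <= y -> T x <= T y).
Context (T_cvg : forall B, exists X, forall x, X <= x -> B <= T x).
Context (T_support : forall x y, Phi x + T x * (y - x) <= Phi y).

(* With x_k the first point where T reaches the k-th level, T varies by at most
   one level step near every x outside the intervals [x_k - d_k, x_k + d_k]. *)
Lemma borel_growth (B e dl : R) : 0 < B -> 0 < e -> 0 < dl ->
  exists (c d : nat -> R) (X : R),
  [/\ forall k, 0 <= d k, forall n, \sum_(k < n) d k <= dl &
   forall x, X <= x -> (forall k, ~ (c k - d k <= x <= c k + d k)) ->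
     forall h, `|h| <= B / Num.sqrt (psi (T x)) ->
       Phi (x + h) <= Phi x + T x * h + B * e].
Proof.
move=> B0 e0 d0.
pose xk k := inf [set x | 0 <= x /\ level e k <= T x].
have ne k : [set x | 0 <= x /\ level e k <= T x] !=set0.
  have [X hX] := T_cvg (level e k); exists (Num.max 0 X); split.
    by rewrite le_max lexx.
  by apply: hX; rewrite le_max lexx orbT.
have xk_ge0 k : 0 <= xk k by apply: lb_le_inf => // x [].
have xk_le k x : 0 <= x -> level e k <= T x -> xk k <= x.
  by move=> x0 hx; apply: ge_inf => //; exists 0 => y [].
have le_xk k x : T x < level e k -> x <= xk k.
  move=> hx; apply: lb_le_inf => // y [y0 hy]; rewrite leNgt; apply/negP => yx.
  by have := T_incr (ltW yx); lra.
pose u k := (Num.sqrt (psi (level e k)))^-1.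
have u0 k : 0 <= u k by rewrite invr_ge0 sqrtr_ge0.
have [C uC] := sum_inv_sqrt_bounded e0.
have dB : 0 < dl / B by rewrite divr_gt0.
have [N hN] := summable_tail u0 uC dB.
have [X hX] := T_cvg (level e N.+1).
(* The radius at the crossing of a level uses the preceding level: a point just before the crossing
   still has its index there, and its window is correspondingly longer. *)
exists (fun j => xk (N.+1 + j)%N), (fun j => B * u (N + j)%N), (Num.max 0 X); split.
- by move=> k; rewrite mulr_ge0 ?(ltW B0).
- by move=> n; rewrite -mulr_sumr mulrC -ler_pdivlMr.
move=> x; rewrite ge_max => /andP[x0 Xx] out h hB.
have TN := hX _ Xx.
have [k [Nk kT Tk]] : exists k, [/\ (N < k)%N, level e k <= T x & T x < level e k.+1].
  have mono i j : (i <= j)%N -> level e i <= level e j.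
    move=> /subnK <-; elim: (j - i)%N => [|n ih]; first by rewrite add0n.
    by rewrite addSn; apply: le_trans ih (levelS _ e0).
  have [m mP mmin] := ex_minnP (level_unbounded (T x) e0).
  have Nm : (N.+1 < m)%N.
    by rewrite ltnNge; apply/negP => /mono; lra.
  case: m mP mmin Nm => // m mP mmin Nm; exists m; split => //.
  by rewrite leNgt; apply/negP => /mmin; rewrite ltnn.
have lk := level_gt0 k e0.
have Tx0 : t0 < T x := lt_le_trans lk kT.
have sk : 0 < Num.sqrt (psi (level e k)) by apply: sqrt_psi_gt0; rewrite ltW.
have sT : Num.sqrt (psi (level e k)) <= Num.sqrt (psi (T x)).
  by apply: ler_wsqrtr; exact: psi_incr.
have sT0 := lt_le_trans sk sT.
pose H := B / Num.sqrt (psi (T x)).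
have H0 : 0 < H by rewrite divr_gt0.
have HBu j : (j <= k)%N -> H <= B * u j.
  move=> jk; rewrite ler_pM2l// lef_pV2 ?posrE//; last first.
    by apply: sqrt_psi_gt0; rewrite ltW// level_gt0.
  apply: le_trans _ sT; apply: ler_wsqrtr; apply: psi_incr; first exact: level_gt0.
  move: jk => /subnK <-; elim: (k - j)%N => [|n ih]; first by rewrite add0n.
  by rewrite addSn; apply: le_trans ih (levelS _ e0).
have step : level e k.+1 - level e k = e * Num.sqrt (psi (level e k)).
  by rewrite /= addrC addKr.
have HB : H * (e * Num.sqrt (psi (level e k))) <= B * e.
  rewrite /H mulrC -mulrA [X in e * X]mulrC -[leRHS]mulrC.
  rewrite ler_pM2l// mulrAC ler_pdivrMr// ler_pM2l//.
have right y : x <= y -> y <= x + H -> T y < level e k.+1.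
  move=> xy yH; rewrite ltNge; apply/negP => Ty.
  have xky := xk_le _ _ (le_trans x0 xy) Ty.
  have xxk := le_xk _ _ Tk.
  have := out (k - N)%N; rewrite (_ : (N.+1 + (k - N))%N = k.+1); last by rewrite addSn subnKC// ltnW.
  rewrite subnKC; last exact: ltnW.
  apply; have := HBu k (leqnn k); have := u0 k => ? ?.
  by apply/andP; split; lra.
have left y : y <= x -> x - H <= y -> level e k <= T y.
  move=> yx yH; rewrite leNgt; apply/negP => Ty.
  have xky := le_xk _ _ Ty.
  have xxk := xk_le _ _ x0 kT.
  have := out (k - N.+1)%N; rewrite subnKC//.
  rewrite (_ : (N + (k - N.+1))%N = k.-1); last first.
    by case: k {kT Tk lk sk sT HBu step HB right Ty xky xxk} Nk yH => // k Nk _; rewrite subSS subnKC.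
  apply; have := HBu k.-1 (leq_pred k) => ?.
  by apply/andP; split; lra.
have := T_support (x + h) x; rewrite (_ : x - (x + h) = - h); last by ring.
move: hB; rewrite -/H => hB.
have key : (T (x + h) - T x) * h <= B * e.
  apply: le_trans HB; rewrite -step mulrC.
  have [hp|hn] := leP 0 h.
    rewrite ger0_norm// in hB.
    have r : T (x + h) < level e k.+1 by apply: right; lra.
    have m : T x <= T (x + h) by apply: T_incr; lra.
    by apply: ler_pM; lra.
  rewrite ltr0_norm// in hB.
  have r : level e k <= T (x + h) by apply: left; lra.
  have m : T (x + h) <= T x by apply: T_incr; lra.
  have -> : h * (T (x + h) - T x) = (- h) * (T x - T (x + h)) by ring.
  by apply: ler_pM; lra.
by lra.
Qed.

End BorelLemma.

(** * From the topological definition of a direct tract to estimates *)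

Section DirectTract.
Context {R : realType}.
Implicit Types (z w : R[i]) (f : R[i] -> R[i]) (D : set R[i]).

Lemma normr_normc z : `|z| = (normc z)%:C.
Proof. by rewrite normc_def normc_sqrt. Qed.

Lemma nbhs_cnear z (P : set R[i]) : nbhs z P <-> cnear z P.
Proof.
split.
  move/nbhs_ballP => [e /= e0 eP].
  (* Radii of balls in [R[i]] are complex numbers, and being positive forces them to be real. *)
  have eR : e = (Re e)%:C.
    by rewrite [LHS]complexE (_ : Im e = 0) ?mulr0 ?addr0//; apply: ger0_Im; exact: ltW.
  exists (Re e); first by rewrite -ltcR -eR.
  move=> w wz; apply: eP; rewrite -ball_normE /= normr_normc eR ltcR.
  by rewrite normcB.
move=> [e e0 eP]; apply/nbhs_ballP; exists e%:C; first by rewrite /= ltcR.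
move=> w; rewrite -ball_normE /= normr_normc ltcR normcB; exact: eP.
Qed.

Lemma open_cnear D z : open D -> D z -> cnear z D.
Proof. by move=> Do Dz; apply/nbhs_cnear; exact: open_nbhs_nbhs. Qed.

Lemma cnear_open D : (forall z, D z -> cnear z D) -> open D.
Proof. by move=> h; rewrite openE => z /h /nbhs_cnear. Qed.

Lemma derivable_cderiv f z : derivable f z 1 -> exists l, cderiv f z l.
Proof.
move=> /cvg_ex[/= l fl]; exists l => e e0.
have e0' : 0 < e%:C by rewrite ltcR.
move/cvgrPdist_lt : fl => /(_ _ e0').
rewrite near_withinE => /nbhs_cnear[d d0 hd]; exists d => // w wz.
have [->|wn] := eqVneq w z; first by rewrite !subrr mulr0 subr0 normc0 mulr0.
have h0 : w - z != 0 by rewrite subr_eq0.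
have := hd (w - z); rewrite subr0 => /(_ wz h0).
rewrite -[(w - z) *: 1]/((w - z) * 1) mulr1 subrK.
rewrite -[_ *: _]/((w - z)^-1 * _) normr_normc ltcR => h.
have -> : f w - f z - l * (w - z) = - (l - (w - z)^-1 * (f w - f z)) * (w - z) by field.
rewrite normcM normcN; apply: ler_wpM2r; [exact: normc_ge0|exact: ltW].
Qed.

Lemma within_continuous_cnear D f z (e : R) : {within D, continuous f} -> D z ->
  0 < e -> cnear z (fun w => D w -> normc (f w - f z) < e).
Proof.
move=> fc Dz e0; have e0' : 0 < e%:C by rewrite ltcR.
have /cvgrPdist_lt /(_ _ e0') := (subspace_continuousP _ _).1 fc z Dz.
rewrite near_withinE => /nbhs_cnear.
apply: cnear_mono => w h Dw; rewrite normcB -ltcR -normr_normc; exact: h Dw.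
Qed.

Lemma unbounded_normc D : ~ bounded_set D -> forall B : R, exists2 z, D z & B < normc z.
Proof.
move=> nb B; apply: contrapT => h; apply: nb.
exists B%:C; split; first by rewrite complex_real.
move=> M BM z Dz.
suff : (normc z)%:C <= M by rewrite -normr_normc.
by apply: le_trans (ltW BM); rewrite lecR leNgt; apply/negP => Bz; apply: h; exists z.
Qed.

Lemma direct_tract_bound f D : direct_tract f D -> exists rho, tract_bound f D rho.
Proof.
move=> [[Do _ _] _ _ [fd fc] [rho r0 [fb fr]]]; exists rho; split => //.
- by move=> z Dz; exact: open_cnear.
- move=> z Dz; apply: cnear_mono (open_cnear Do Dz) => w /fd; exact: derivable_cderiv.
- move=> z nDz e e0; have [cz|ncz] := pselect (closure D z).
    have bz : boundary D z by split=> // /interior_subset.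
    apply: cnear_mono (within_continuous_cnear fc cz e0) => w h Dw.
    have := h (subset_closure Dw); have := normc_ge_sub (f w) (f z).
    by rewrite (fb _ bz); lra.
  have : cnear z (~` closure D) by apply: open_cnear => //; exact/closed_openC/closed_closure.
  by apply: cnear_mono => w nw Dw; exfalso; apply: nw; exact: subset_closure.
Qed.

(** On a circle of radius r missing D, the conditions |z| < r and |z| <= r cut out the same part of
    D. It is open and closed in D, contains z1 and is proper because D is unbounded. *)
Lemma direct_tract_meets f D : direct_tract f D ->
  exists x0 : R, forall x, x0 <= x -> tract_meets D x.
Proof.
move=> [[Do Dc Du] _ _ _ _].
have [z1 Dz1 _] := unbounded_normc Du 0; exists (normc z1) => x xz.
apply: contrapT => nx.
pose r := expR x.
have z1r : normc z1 < r by have := expR_ge1Dx x; rewrite /r; lra.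
have nr z : D z -> normc z != r by move=> Dz; apply/eqP => zr; apply: nx; exists z.
have [z2 Dz2 z2r] := unbounded_normc Du r.
pose B := D `&` [set z | normc z < r].
have : B = D.
  apply: Dc.
  - by exists z1.
  - exists [set z | normc z < r] => //; apply: cnear_open => z /= zr.
    exact: ccont_lt (cholo_cont (cholo_id z)) zr.
  - exists [set z | normc z <= r].
      rewrite -[X in closed X]setCK; apply: open_closedC; apply: cnear_open => z /=.
      move/negP; rewrite -ltNge => zr.
      apply: cnear_mono (ccont_gt (cholo_cont (cholo_id z)) zr) => w /=.
      by rewrite ltNge => /negP.
    rewrite predeqE => z; split=> -[Dz /= zr]; split=> //=; first exact: ltW.
    by rewrite lt_neqAle zr nr.
rewrite predeqE => /(_ z2) [_ /(_ Dz2)] [_ /=].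
by lra.
Qed.

End DirectTract.

(** * Logarithmic measure of countable unions of intervals *)

Section LogarithmicMeasure.
Context {R : realType}.
Notation mu := (@lebesgue_measure R).

Lemma measurable_inv_ge1 : measurable_fun `[(1 : R), +oo[%classic (EFin \o (fun t : R => t^-1)).
Proof.
apply/measurable_EFinP.
apply: (@measurable_funS _ _ _ _ `](0 : R), +oo[%classic) => //.
  by move=> t /=; rewrite !in_itv/= !andbT; lra.
apply: open_continuous_measurable_fun; first exact: interval_open.
move=> t; rewrite inE/= in_itv/= andbT => tt.
by apply: inv_continuous; rewrite gt_eqF.
Qed.

Definition log_interval (c d : R) : set R :=
  `[expR (c - d), expR (c + d)] `&` `[(1 : R), +oo[.

(** Length times the largest value of 1 / t replaces the exact integral 2 d: the result exp (2 d) -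
    1 is at most 32 d, since exp (2 d) <= 16 for d <= 1. *)
Lemma log_interval_measure (c d : R) : 0 <= d -> d <= 1 ->
  (\int[mu]_(t in log_interval c d) (t^-1)%:E <= (32 * d)%:E)%E.
Proof.
move=> d0 d1.
have mI : measurable (log_interval c d) by exact: measurableI.
apply: (@le_trans _ _ (\int[mu]_(t in log_interval c d) (expR (d - c))%:E)%E).
  apply: ge0_le_integral => //=.
  - move=> t [_]; rewrite /= in_itv/= andbT => t1; rewrite lee_fin invr_ge0; lra.
  - by apply: measurable_funS measurable_inv_ge1 => //; exact: subIsetr.
  - move=> t [/= + _]; rewrite in_itv/= => /andP[t1 _]; rewrite lee_fin.
    rewrite (_ : d - c = - (c - d)); last by ring.
    by rewrite expRN lef_pV2 ?posrE ?expR_gt0// (lt_le_trans _ t1)// expR_gt0.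
rewrite integral_cst//=.
apply: (@le_trans _ _ ((expR (d - c))%:E * mu `[expR (c - d), expR (c + d)])%E).
  rewrite lee_pmul2l ?lte_fin ?expR_gt0//; apply: le_measure; rewrite ?inE//.
  exact: subIsetl.
rewrite lebesgue_measure_itv/= lte_fin ltr_expR.
case: ifPn => [cd|_]; last by rewrite mule0 lee_fin; lra.
rewrite -EFinB -EFinM lee_fin mulrBr -!expRD.
rewrite (_ : d - c + (c + d) = 2 * d); last by ring.
rewrite (_ : d - c + (c - d) = 0); last by ring.
rewrite expR0.
have h : 1 - 2 * d <= expR (- (2 * d)) by have := expR_ge1Dx (- (2 * d)); lra.
have e2 : expR (2 * d) <= 16.
  apply: (@le_trans _ _ (expR (1 + 1))); first by rewrite ler_expR; lra.
  rewrite expRD; have := expR1_le4 (R := R); have := expR_gt0 (1 : R) => p q.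
  have : expR 1 * expR 1 <= 4 * 4 :> R by apply: ler_pM => //; exact: ltW.
  lra.
have : expR (2 * d) * (1 - 2 * d) <= expR (2 * d) * expR (- (2 * d)).
  by rewrite ler_wpM2l ?expR_ge0.
rewrite -expRD subrr expR0 => k.
have : expR (2 * d) * (2 * d) <= 16 * (2 * d) by rewrite ler_wpM2r//; lra.
by lra.
Qed.

Lemma integral_bigcup_le (F : (set R)^nat) (B : R) :
  (forall k, measurable (F k)) -> (forall k, F k `<=` `[(1 : R), +oo[) ->
  (forall n, (\sum_(k < n) \int[mu]_(t in F k) (t^-1)%:E <= B%:E)%E) ->
  (\int[mu]_(t in \bigcup_k F k) (t^-1)%:E <= B%:E)%E.
Proof.
move=> mF F1 FB.
have mU : measurable (\bigcup_k F k) by exact: bigcup_measurable.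
have U1 : \bigcup_k F k `<=` `[(1 : R), +oo[ by move=> t [k _ /F1].
have mf (A : set R) : measurable A -> A `<=` `[(1 : R), +oo[ ->
    measurable_fun A (EFin \o (fun t : R => t^-1)).
  by move=> mA A1; exact: measurable_funS measurable_inv_ge1.
have p0 t : `[(1 : R), +oo[%classic t -> (0 <= (t^-1)%:E)%E.
  by rewrite /= in_itv/= andbT => h; rewrite lee_fin invr_ge0; lra.
have mD k : measurable (seqDU F k) by apply: seqDU_measurable.
have mU' : measurable (\bigcup_k seqDU F k) by rewrite -seqDU_bigcup_eq.
have U1' : \bigcup_k seqDU F k `<=` `[(1 : R), +oo[ by rewrite -seqDU_bigcup_eq.
rewrite seqDU_bigcup_eq ge0_integral_bigcup; [|exact: mD|exact: mf mU' U1'|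
  by move=> t /U1' /p0|exact: trivIset_seqDU].
apply: lime_le.
  by apply: is_cvg_nneseries => k _ _; apply: integral_ge0 => t st; apply: p0; apply: (F1 k); exact: subset_seqDU st.
apply: nearW => n; rewrite big_mkord; apply: le_trans (FB n).
apply: lee_sum => k _; apply: ge0_subset_integral => //.
- exact: mD.
- exact: mF.
- exact: mf (mF k) (F1 k).
- by move=> t Ft; apply: p0; exact: F1 Ft.
- exact: subset_seqDU.
Qed.

Lemma log_intervals_measure (c d : nat -> R) (dl : R) : dl <= 1 ->
  (forall k, 0 <= d k) -> (forall n, \sum_(k < n) d k <= dl) ->
  (\int[mu]_(t in \bigcup_k log_interval (c k) (d k)) (t^-1)%:E <= (32 * dl)%:E)%E.
Proof.
move=> dl1 d0 dsum.
have dle k : d k <= dl.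
  apply: le_trans (dsum k.+1); rewrite big_ord_recr/= lerDr; exact: sumr_ge0.
apply: integral_bigcup_le.
- by move=> k; exact: measurableI.
- by move=> k; exact: subIsetr.
- move=> n; apply: (@le_trans _ _ (\sum_(k < n) (32 * d k)%:E)%E).
    apply: lee_sum => k _; apply: log_interval_measure => //.
    exact: le_trans (dle k) dl1.
  by rewrite sumEFin lee_fin -mulr_sumr ler_wpM2l.
Qed.

End LogarithmicMeasure.

(** * The principal logarithm near 1 *)

Section PrincipalLogarithm.
Context {R : realType}.
Implicit Types (w : R[i]).

(** For th > 0 the mean value theorem gives sin th = th cos c with 0 < c < th, and cos decreases on
    [0, pi], so cos c > 1/3. *)
Lemma ler_norm_sin (th : R) : `|th| <= pi -> 1 / 3 <= cos th -> `|th| <= 3 * `|sin th|.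
Proof.
wlog th0 : th / 0 <= th => [H|].
  have [h|h] := leP 0 th; first exact: H.
  by move=> h1 h2; have := H (- th); rewrite normrN sinN cosN normrN; apply => //; lra.
rewrite ger0_norm// => tpi ct.
move: th0; rewrite le_eqVlt => /orP[/eqP <-|th0]; first by rewrite sin0 normr0 mulr0.
have sc : {within `[0, th], continuous (@sin R)}.
  by apply: continuous_subspaceT => x; exact: continuous_sin.
have [c] := MVT th0 (fun x _ => is_derive_sin x) sc.
rewrite in_itv/= sin0 !subr0 => /andP[c0 cth] E.
have cc : cos th < cos c.
  by rewrite ltr_cos// in_itv/= ?(ltW c0) ?(ltW th0) ?tpi ?(le_trans (ltW cth)).
have : sin th <= `|sin th| by exact: ler_norm.
rewrite E => h.
have : 1 / 3 * th <= cos c * th by rewrite ler_wpM2r ?(ltW th0)//; lra.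
by lra.
Qed.

(** The argument determines the constant: 1/2 <= |w| <= 3/2 and Re w >= 1/2 give cos >= 1/3, and |Im
    w| <= eta gives |sin| <= 2 eta, hence 6 = 3 * 2. *)
Lemma principal_log_small w (eta : R) : eta <= 1 / 2 -> normc (w - 1) <= eta ->
  [/\ w != 0, `|ln (normc w)| <= 6 * eta & `|principal_arg w| <= 6 * eta].
Proof.
move=> e2 we.
have e0 : 0 <= eta := le_trans (normc_ge0 _) we.
have wl : 1 - eta <= normc w.
  by have := normc_ge_sub 1 w; rewrite normcB normc1; lra.
have wu : normc w <= 1 + eta.
  by have := normc_ge_sub w 1; rewrite normc1; lra.
have w0 : 0 < normc w by lra.
have wn : w != 0 by rewrite -normc_gt0.
split => //.
  have h1 : 1 + ln (normc w) <= normc w by rewrite -[leRHS]lnK// expR_ge1Dx.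
  have h2 : 1 - ln (normc w) <= (normc w)^-1.
    by rewrite -[in leRHS](lnK w0) -expRN expR_ge1Dx.
  have h3 : (normc w)^-1 <= 1 + 2 * eta.
    by rewrite -[leLHS]mul1r ler_pdivrMr//; nra.
  by rewrite ler_norml; apply/andP; split; lra.
have [tpi E] := principal_argP wn; set th := principal_arg w in tpi E *.
have Ew : w = (normc w * cos th) +i* (normc w * sin th).
  rewrite [LHS]E /cexp /= lnK//.
  by apply/eqP; rewrite eq_complex /= !mul0r subr0 addr0 !eqxx.
have Rw : normc w * cos th - 1 = Re (w - 1) by rewrite {2}Ew.
have Iw : normc w * sin th = Im (w - 1) by rewrite {2}Ew/= subr0.
have c3 : 1 / 3 <= cos th.
  rewrite -(ler_pM2l w0); have := le_trans (Re_le_normc (w - 1)) we.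
  by rewrite -Rw ler_norml => /andP[? ?]; lra.
have s2 : `|sin th| <= 2 * eta.
  have := le_trans (Im_le_normc (w - 1)) we.
  rewrite -Iw normrM (ger0_norm (ltW w0)) => h.
  have : 1 / 2 * `|sin th| <= normc w * `|sin th| by rewrite ler_wpM2r//; lra.
  by lra.
by have := ler_norm_sin tpi c3; lra.
Qed.

End PrincipalLogarithm.

(** Matches the error B / (j + 1) of the growth lemma with B = 1920 to the error ln (1 + e) that
    rigidity tolerates. *)
Lemma error_choice {R : realType} (eps : R) : 0 < eps -> exists e (j : nat),
  [/\ 0 < e, e <= 1 / 64, 2 * e < eps & 1920 * j.+1%:R^-1 <= ln (1 + e)].
Proof.
move=> eps0; pose e := Num.min (eps / 4) (1 / 64).
have e0 : 0 < e by rewrite lt_min; apply/andP; split; lra.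
have e64 : e <= 1 / 64 by rewrite ge_min lexx orbT.
have e4 : e <= eps / 4 by rewrite ge_min lexx.
have q0 : 0 <= 1920 * 2 / e by apply: divr_ge0; [lra|exact: ltW].
pose j := Num.bound (1920 * 2 / e); exists e, j; split=> //; first by lra.
apply: (@le_trans _ _ (e / 2)); last by apply: ln1D_ge; lra.
have := archi_boundP q0; rewrite -/j (ltr_pdivrMr _ _ e0) => h.
have j0 : 0 < j.+1%:R :> R by rewrite ltr0n.
by rewrite (ler_pdivrMr _ _ j0) -natr1; lra.
Qed.

(** * The asymptotic relation on a single disk *)

Section WimanValiron.
Context {R : realType} (f : R[i] -> R[i]) (D : set R[i]) (rho : R).
Context (tract : tract_bound f D rho).
Notation Phi := (log_growth f D rho).
Notation T := (right_slope Phi).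

Lemma tract_index_slope (x0 x : R) : (forall y, x0 <= y -> tract_meets D y) ->
  x0 <= x -> tract_index f D (expR x) = T x.
Proof.
move=> meets x0x; rewrite /tract_index expRK.
apply: right_derivative_slope; first exact: log_growth_convex.
move=> y xy; rewrite (log_max_modulus tract)//; apply: meets; exact: le_trans xy.
Qed.

(** The logarithm of z / zr lies in a square of half side 6 eta, and rigidity there needs Phi on a
    window 320 times larger. *)
Lemma disk_asymptotics (zr z : R[i]) (x eta e : R) :
  0 < eta -> eta <= 1 / 2 -> 0 < e -> e <= 1 / 64 ->
  D zr -> normc zr = expR x -> normc (f zr) = expR (Phi x) ->
  (forall h, `|h| <= 1920 * eta -> Phi (x + h) <= Phi x + T x * h + ln (1 + e)) ->
  (forall h, `|h| <= 1920 * eta -> ln rho + 9 <= Phi x + T x * h) ->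
  normc (z - zr) <= expR x * eta ->
  D z /\ normc (f z / (principal_power (z / zr) (T x) * f zr) - 1) <= 2 * e.
Proof.
move=> eta0 eta2 e0 e64 Dzr nzr fzr up low zin.
have zr0 : zr != 0 by rewrite -normc_gt0 nzr expR_gt0.
have wz : normc (z / zr - 1) <= eta.
  rewrite (_ : z / zr - 1 = (z - zr) / zr); last by field.
  by rewrite normcM normcV nzr ler_pdivrMr ?expR_gt0// mulrC.
have [w0 l1 l2] := principal_log_small eta2 wz.
have [_ Ezr] := principal_argP zr0; rewrite nzr expRK in Ezr.
have [_ Ew] := principal_argP w0.
set s0 := _ +i* _ in Ezr; set sg := _ +i* _ in Ew.
have Ez : z = cexp (s0 + sg) by rewrite cexpD -Ezr -Ew; field.
have E6 : 320 * (6 * eta) = 1920 * eta by ring.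
have := @log_rigidity R f D rho tract x s0 (T x) (6 * eta) e.
rewrite E6 -Ezr => /(_ _ e0 e64 erefl Dzr fzr up low (s0 + sg)) [].
- by lra.
- by split; rewrite addrC addKr.
rewrite -Ez => Dz H; split => //; move: H.
rewrite (principal_power_cexp _ w0) -/sg (_ : s0 + sg - s0 = sg); last by ring.
by rewrite [f zr * _]mulrC.
Qed.

End WimanValiron.

Theorem theorem1p1 (R : realType) (t0 : R) (psi psi' : R -> R) (K L : R)
    (f : R[i] -> R[i]) (D : set R[i]) (zeta : R -> R[i]) :
  0 < t0 ->
  (forall t : R, t0 <= t -> 0 < psi t) ->
  (forall t : R, t0 <= t ->
     has_derivative_within [set s : R | t0 <= s] psi t (psi' t)) ->
  (\int[lebesgue_measure]_(t in [set t : R | (t0 <= t)%R]) ((psi t)^-1)%:E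
     < +oo)%E ->
  0 < K -> K <= 1 -> 1 < L -> L < 2 ->
  (forall t : R, t0 <= t ->
     K <= t * psi' t / psi t /\ t * psi' t / psi t <= L) ->
  direct_tract f D ->
  (forall r : R, 0 < r -> (exists z : R[i], D z /\ normc z = r) ->
     [/\ D (zeta r), normc (zeta r) = r
       & normc (f (zeta r)) = max_modulus f D r]) ->
  exists F : set R,
    [/\ measurable F,
        F `<=` [set t : R | 1 <= t],
        (\int[lebesgue_measure]_(t in F) (t^-1)%:E < +oo)%E
      & forall eps : R, 0 < eps -> exists r0 : R, forall r : R,
          r0 <= r -> ~ F r ->
          forall z : R[i],
            normc (z - zeta r) <= r / Num.sqrt (psi (tract_index f D r)) ->
            D z /\
            normc (f z /
                   (principal_power (z / zeta r) (tract_index f D r) *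
                    f (zeta r)) - 1) < eps].
Proof.
move=> t00 psi0 psiD psiI K0 K1 L1 L2 psiB DT zetaP.
have [rho tract] := direct_tract_bound DT.
have [x0 meets] := direct_tract_meets DT.
have [[_ _ Du] _ Cu _ _] := DT.
have Dn0 : D !=set0 by have [z Dz _] := unbounded_normc Du 0; exists z.
have Cunb := unbounded_normc Cu.
pose Phi := log_growth f D rho; pose T := right_slope Phi.
have PhiC : convex_chord Phi := log_growth_convex tract.
have Tcvg : forall B : R, exists X, forall x, X <= x -> B <= T x :=
  index_cvg tract Dn0 Cunb meets.
have psiB2 t : t0 <= t -> 0 <= t * psi' t / psi t /\ t * psi' t / psi t <= 2.
  by move=> /psiB[? ?]; split; lra.
have psi_c t : t0 < t -> {for t, continuous psi} by exact: (psi_continuous psiD).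
have psi_i s t : t0 < s -> s <= t -> psi s <= psi t by exact: (psi_nondecr t00 psi0 psiD psiB2).
have psi_s s t : t0 < s -> s <= t -> psi t <= (t / s) ^+ 2 * psi s.
  exact: (psi_div_sqr_nonincr t00 psi0 psiD psiB2).
have {}psiI : (\int[lebesgue_measure]_(t in `[t0, +oo[) ((psi t)^-1)%:E < +oo)%E.
  rewrite (_ : `[t0, +oo[%classic = [set t : R | t0 <= t])//.
  by rewrite predeqE => t /=; rewrite in_itv/= andbT.
have half j : 0 < 2^-1 ^+ j :> R by rewrite exprn_gt0// invr_gt0.
have ej j : 0 < j.+1%:R^-1 :> R by rewrite invr_gt0.
have B0 : 0 < 1920 :> R by lra.
(* The error shrinks like 1 / (j + 1) while the exceptional intervals have half lengths summing to
   at most 2^-j, so one F can serve every eps. *)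
have growth j := borel_growth t00 psi0 psi_c psi_i psi_s psiI
  (fun x y => right_slope_nondecr PhiC (x := x) (y := y)) Tcvg
  (right_slope_support PhiC) B0 (ej j) (half j).
have [c /choice[d /choice[X bad]]] := choice growth.
pose F := \bigcup_j \bigcup_k log_interval (c j k) (d j k).
have F1 j : \bigcup_k log_interval (c j k) (d j k) `<=` `[(1 : R), +oo[.
  by move=> t [k _ []].
have mF j : measurable (\bigcup_k log_interval (c j k) (d j k)).
  by apply: bigcup_measurable => k _; exact: measurableI.
exists F; split.
- exact: bigcup_measurable.
- by move=> t [j _ /F1] /=; rewrite in_itv/= andbT.
- apply: (@le_lt_trans _ _ (64%:E)%E); last exact: ltry.
  apply: integral_bigcup_le => // n.
  apply: (@le_trans _ _ (\sum_(j < n) (32 * 2^-1 ^+ j)%:E)%E).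
    apply: lee_sum => j _; have [d0 dsum _] := bad j.
    apply: log_intervals_measure => //.
    by rewrite exprn_ile1 ?invr_ge0// invf_le1 ?ler1n.
  rewrite sumEFin lee_fin -mulr_sumr.
  have -> : \sum_(j < n) 2^-1 ^+ j = 2 * (1 - 2^-1 ^+ n) :> R.
    elim: n => [|n ih]; first by rewrite big_ord0 expr0 subrr mulr0.
    by rewrite big_ord_recr/= ih exprS; field.
  by have := half n; lra.
move=> eps eps0.
have [e [j [e0 e64 e4 jP]]] := error_choice eps0.
have [_ _ badj] := bad j.
have [Y hY] := sqrt_psi_large t00 psi0 psi_c psi_i psi_s psiI.
have [X1 hX1] := Tcvg Y.
have [X2 hX2] := log_growth_cvg tract Dn0 Cunb (ln rho + 10).
(* As eta <= 1/2, the window reaches at most 960 to the left and stays beyond X2. The bound 0 gives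
   r >= 1, because F only records the part of its intervals in [1, oo). *)
pose Z := Num.max (Num.max (X j) X1) (Num.max (X2 + 960) (Num.max x0 0)).
exists (expR Z) => r rZ nF z.
have r0 : 0 < r := lt_le_trans (expR_gt0 _) rZ.
pose x := ln r; have rx : r = expR x by rewrite lnK.
have : Z <= x by rewrite -(expRK Z) ler_ln ?posrE ?expR_gt0.
rewrite /Z !ge_max => /andP[/andP[Xx X1x] /andP[X2x /andP[x0x xge0]]].
have mx := meets _ x0x.
have [Dzr nzr fzr] : [/\ D (zeta r), normc (zeta r) = r & normc (f (zeta r)) = max_modulus f D r].
  by apply: zetaP => //; rewrite rx.
rewrite [tract_index f D r](_ : _ = T x); last by rewrite rx; exact: (tract_index_slope tract meets).
pose eta := (Num.sqrt (psi (T x)))^-1.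
have s2 : 2 <= Num.sqrt (psi (T x)) by apply: hY; exact: hX1.
have s0 : 0 < Num.sqrt (psi (T x)) := lt_le_trans (ltr0Sn _ 1) s2.
have eta0 : 0 < eta by rewrite invr_gt0.
have eta2 : eta <= 1 / 2 by rewrite div1r lef_pV2// posrE.
have up h : `|h| <= 1920 * eta -> Phi (x + h) <= Phi x + T x * h + ln (1 + e).
  rewrite /eta => hh.
  have out k : ~ (c j k - d j k <= x <= c j k + d j k).
    move=> /andP[k1 k2]; apply: nF; exists j => //; exists k => //; split.
      by rewrite /= in_itv/= rx !ler_expR k1 k2.
    by rewrite /= in_itv/= andbT rx -expR0 ler_expR.
  apply: le_trans (badj x Xx out h hh) _.
  by rewrite lerD2l.
have low h : `|h| <= 1920 * eta -> ln rho + 9 <= Phi x + T x * h.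
  move=> hh; have g : ln rho + 10 <= Phi (x + h).
    apply: hX2; move: hh; rewrite ler_norml => /andP[hh _].
    by move: eta2 X2x hh; clear; lra.
  have l1 : ln (1 + e) <= e by apply: le_ln1Dx; move: e0; clear; lra.
  by move: (up h hh) g l1 e64; clear; lra.
move=> zin.
have nzx : normc (zeta r) = expR x by rewrite nzr.
have fzx : normc (f (zeta r)) = expR (Phi x).
  by rewrite fzr rx (log_max_modulus tract mx) (expR_log_growth tract).
have [|Dz H] := disk_asymptotics tract eta0 eta2 e0 e64 Dzr nzx fzx up low (z := z).
  by rewrite -rx.
by split=> //; exact: le_lt_trans e4.
Qed.
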